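(* Let $n\ge1$ and let the coefficient ring $\mathbb{K}$ of the Hecke algebra $\mathcal{H}_n$ contain $Q^{-1}$ and the rational numbers. Then the set of elements $\{\mathcal{N}_\lambda(T_{\omega_\lambda}^2)\}_\lambda$, $\lambda$ running over the partitions of $n$, is a basis of the center of $\mathcal{H}_n$. The matrix expressing this basis in terms of the basis $\{\Gamma_\lambda\}$ is $H2M\cdot D$, where $D$ is the diagonal matrix with entries $Q^{n-\ell(\lambda)}$. That is, for every partition $\lambda$ of $n$, $$\mathcal{N}_\lambda(T_{\omega_\lambda}^2)=\sum_{\mu\vdash n}H2M[\lambda,\mu]\,Q^{n-\ell(\mu)}\,\Gamma_\mu .$$
   Context: $\mathbb{K}$ is a commutative ring containing an invertible element $q$; $Q=q-q^{-1}$. $\mathcal{H}_n$ is the $\mathbb{K}$-algebra generated by $T_1,\dots,T_{n-1}$ with relations $T_iT_{i+1}T_i=T_{i+1}T_iT_{i+1}$, $T_iT_j=T_jT_i$ for $|i-j|>1$, and $T_i^2=QT_i+1$. For $w\in\mathfrak{S}_n$ with reduced word $s_{a_1}\cdots s_{a_l}$ ($s_i$ the transposition of $i,i+1$), $T_w=T_{a_1}\cdots T_{a_l}$; the $T_w$ form a $\mathbb{K}$-basis of $\mathcal{H}_n$. For a composition $I=[i_1,\dots,i_r]$ of $n$ (vector of positive integers of sum $n$), $\mathfrak{S}_I=\mathfrak{S}_{i_1}\times\cdots\times\mathfrak{S}_{i_r}\subset\mathfrak{S}_n$ is the Young subgroup, $\omega_I$ is its element of maximal length, and $\mathcal{H}(\mathfrak{S}_I)\subset\mathcal{H}_n$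 is the span of the $T_w$, $w\in\mathfrak{S}_I$. The normalization map is $$\mathcal{N}_I:\mathcal{H}(\mathfrak{S}_I)\to\mathcal{H}_n,\qquad \mathcal{N}_I(h)=\sum_{w\in\mathfrak{S}_n/\mathfrak{S}_I}T_w\,h\,T_{w^{-1}},$$ the sum being over the minimal length representatives $w$ of the left cosets $w\mathfrak{S}_I$. $\Gamma_\lambda$ ($\lambda\vdash n$) is the Geck--Rouquier basis of the center of $\mathcal{H}_n$: over $\mathbb{Z}[Q]$ with $Q$ an indeterminate, $\Gamma_\lambda$ is the unique central element which specializes at $Q=0$ to the conjugacy class sum $\mathcal{C}_\lambda=\sum_w T_w$ ($w$ of cycle type $\lambda$), and such that the expansion of $\Gamma_\lambda-\mathcal{C}_\lambda$ in the basis $T_w$ involves no $w$ which is of minimal length in its conjugacy class of $\mathfrak{S}_n$; for general $\mathbb{K}$ one takes its image under $Q\mapsto q-q^{-1}$. $\ell(\lambda)$ is the number of parts of $\lambda$. $H2M$ is the matrix, indexed by partitions of $n$, defined by $h^\lambda=\sum_\mu H2M[\lambda,\mu]\,m_\mu$, where $h^\lambda=h_{\lambda_1}h_{\lambda_2}\cdots$ are products of complete symmetric functions and $m_\mu$ are the monomial symmetric functions. *)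

(* Defs.v *)
From HB Require Import structures.
From mathcomp Require Import all_boot all_order all_algebra all_fingroup.
From mathcomp Require Import generic_quotient boolp classical_sets mpoly.

Set Implicit Arguments.
Unset Strict Implicit.
Unset Printing Implicit Defensive.

Import GRing.Theory.
Local Open Scope ring_scope.
Local Open Scope quotient_scope.

(* The Hecke algebra is presented by generators and relations: terms in the   *)
(* generators, modulo the congruence generated by the axioms of associative   *)
(* unital R-algebras and the Hecke relations. It is defined over any          *)
(* commutative ring R and parameter Q, so that both the K-algebra with        *)
(* Q = q - q^-1 and the Z[Q]-algebra are instances. There are n.-1            *)
(* generators, indexed from 0.                                                *)

Inductive hterm (R : Type) (m : nat) : Type :=
| HZero
| HOne
| HGen of 'I_m
| HAdd of hterm R m & hterm R m
| HScale of R & hterm R m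
| HMul of hterm R m & hterm R m.

Arguments HZero {R m}.
Arguments HOne {R m}.
Arguments HGen {R m}.

HB.instance Definition _ (R : Type) (m : nat) := gen_eqMixin (hterm R m).
HB.instance Definition _ (R : Type) (m : nat) := gen_choiceMixin (hterm R m).

Section HeckeAlgebra.

Variables (R : comNzRingType) (n : nat) (Q : R).

Local Notation term := (hterm R n.-1).

Inductive hcong : term -> term -> Prop :=
| hc_refl x : hcong x x
| hc_sym x y : hcong x y -> hcong y x
| hc_trans y x z : hcong x y -> hcong y z -> hcong x z
| hc_add x x' y y' :
    hcong x x' -> hcong y y' -> hcong (HAdd x y) (HAdd x' y')
| hc_scale a x x' : hcong x x' -> hcong (HScale a x) (HScale a x')
| hc_mul x x' y y' :
    hcong x x' -> hcong y y' -> hcong (HMul x y) (HMul x' y')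
| hc_addA x y z : hcong (HAdd x (HAdd y z)) (HAdd (HAdd x y) z)
| hc_addC x y : hcong (HAdd x y) (HAdd y x)
| hc_add0 x : hcong (HAdd HZero x) x
| hc_scaleA a b x : hcong (HScale a (HScale b x)) (HScale (a * b) x)
| hc_scale0 x : hcong (HScale 0 x) HZero
| hc_scale1 x : hcong (HScale 1 x) x
| hc_scaleDr a x y :
    hcong (HScale a (HAdd x y)) (HAdd (HScale a x) (HScale a y))
| hc_scaleDl a b x :
    hcong (HScale (a + b) x) (HAdd (HScale a x) (HScale b x))
| hc_mulA x y z : hcong (HMul x (HMul y z)) (HMul (HMul x y) z)
| hc_mul1l x : hcong (HMul HOne x) x
| hc_mul1r x : hcong (HMul x HOne) x
| hc_mulDl x y z : hcong (HMul (HAdd x y) z) (HAdd (HMul x z) (HMul y z))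
| hc_mulDr x y z : hcong (HMul x (HAdd y z)) (HAdd (HMul x y) (HMul x z))
| hc_scaleAl a x y : hcong (HScale a (HMul x y)) (HMul (HScale a x) y)
| hc_scaleAr a x y : hcong (HScale a (HMul x y)) (HMul x (HScale a y))
| hc_braid (i j : 'I_n.-1) : (i.+1 = j :> nat) ->
    hcong (HMul (HMul (HGen i) (HGen j)) (HGen i))
          (HMul (HMul (HGen j) (HGen i)) (HGen j))
| hc_comm (i j : 'I_n.-1) : (i.+1 < j)%N ->
    hcong (HMul (HGen i) (HGen j)) (HMul (HGen j) (HGen i))
| hc_quad (i : 'I_n.-1) :
    hcong (HMul (HGen i) (HGen i)) (HAdd (HScale Q (HGen i)) HOne).

Definition hequiv_rel : rel term := fun x y => `[< hcong x y >].

Lemma hequiv_rel_equiv : equiv_class_of hequiv_rel.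
Proof.
split=> [x | x y | y x z].
- exact/asboolP/hc_refl.
- by apply/asboolP/asboolP; apply: hc_sym.
- by move=> /asboolP xy /asboolP yz; apply/asboolP; apply: hc_trans yz.
Qed.

Canonical hequiv := EquivRelPack hequiv_rel_equiv.

Definition hecke : Type := {eq_quot hequiv}.

HB.instance Definition _ := Choice.on hecke.
HB.instance Definition _ := EqQuotient.on hecke.

Lemma heckeP (x y : term) : reflect (hcong x y) (x == y %[mod hecke]).
Proof. by rewrite eqmodE; apply: asboolP. Qed.

Lemma hecke_eq (x y : term) : hcong x y -> x = y %[mod hecke].
Proof. by move=> /heckeP /eqP. Qed.

Lemma repr_cong (x : term) : hcong (repr (\pi_hecke x)) x.
Proof. by apply/heckeP; rewrite reprK. Qed.

Definition hecke_add (x y : hecke) : hecke :=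
  \pi_hecke (HAdd (repr x) (repr y)).
Definition hecke_opp (x : hecke) : hecke := \pi_hecke (HScale (-1) (repr x)).
Definition hecke_scale (a : R) (x : hecke) : hecke :=
  \pi_hecke (HScale a (repr x)).
Definition hecke_mul (x y : hecke) : hecke :=
  \pi_hecke (HMul (repr x) (repr y)).

Lemma pi_hadd x y :
  hecke_add (\pi_hecke x) (\pi_hecke y) = \pi_hecke (HAdd x y).
Proof. by apply: hecke_eq; apply: hc_add; apply: repr_cong. Qed.
Lemma pi_hscale a x : hecke_scale a (\pi_hecke x) = \pi_hecke (HScale a x).
Proof. by apply: hecke_eq; apply: hc_scale; apply: repr_cong. Qed.
Lemma pi_hopp x : hecke_opp (\pi_hecke x) = \pi_hecke (HScale (-1) x).
Proof. exact: pi_hscale. Qed.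
Lemma pi_hmul x y :
  hecke_mul (\pi_hecke x) (\pi_hecke y) = \pi_hecke (HMul x y).
Proof. by apply: hecke_eq; apply: hc_mul; apply: repr_cong. Qed.

Lemma hecke_addA : associative hecke_add.
Proof.
elim/quotW=> x; elim/quotW=> y; elim/quotW=> z;
  rewrite (pi_hadd y z) (pi_hadd x y) !pi_hadd.
by apply: hecke_eq; apply: hc_addA.
Qed.
Lemma hecke_addC : commutative hecke_add.
Proof.
elim/quotW=> x; elim/quotW=> y;
  rewrite !pi_hadd;
  apply: hecke_eq; apply: hc_addC.
Qed.
Lemma hecke_add0 : left_id (\pi_hecke HZero) hecke_add.
Proof. by elim/quotW=> x; rewrite pi_hadd; apply: hecke_eq; apply: hc_add0. Qed.
Lemma hecke_addN : left_inverse (\pi_hecke HZero) hecke_opp hecke_add.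
Proof.
elim/quotW=> x; rewrite pi_hopp pi_hadd; apply: hecke_eq.
apply: hc_trans (hc_scale0 x); rewrite -(addNr 1); apply: hc_sym.
apply: hc_trans (hc_scaleDl _ _ _) _.
by apply: hc_add; [apply: hc_refl | apply: hc_scale1].
Qed.

HB.instance Definition _ :=
  GRing.isZmodule.Build hecke hecke_addA hecke_addC hecke_add0 hecke_addN.

(* Evaluation in an algebra; used with 2 x 2 matrices to get 1 <> 0. *)
Fixpoint hterm_eval (A : algType R) (a : 'I_n.-1 -> A) (t : term) : A :=
  match t with
  | HZero => 0
  | HOne => 1
  | HGen i => a i
  | HAdd x y => hterm_eval a x + hterm_eval a y
  | HScale c x => c *: hterm_eval a x
  | HMul x y => hterm_eval a x * hterm_eval a y
  end.

Lemma hterm_eval_cong (A : algType R) (a : 'I_n.-1 -> A) :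
  (forall i j : 'I_n.-1, i.+1 = j :> nat ->
    a i * a j * a i = a j * a i * a j) ->
  (forall i j : 'I_n.-1, (i.+1 < j)%N -> a i * a j = a j * a i) ->
  (forall i, a i * a i = Q *: a i + 1) ->
  forall x y, hcong x y -> hterm_eval a x = hterm_eval a y.
Proof.
move=> abraid acomm aquad x y; elim=> //=.
- by move=> ? ? ? _ -> _ ->.
- by move=> ? ? ? ? _ -> _ ->.
- by move=> ? ? ? _ ->.
- by move=> ? ? ? ? _ -> _ ->.
- by move=> *; rewrite addrA.
- by move=> *; rewrite addrC.
- by move=> *; rewrite add0r.
- by move=> *; rewrite scalerA.
- by move=> *; rewrite scale0r.
- by move=> *; rewrite scale1r.
- by move=> *; rewrite scalerDr.
- by move=> *; rewrite scalerDl.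
- by move=> *; rewrite mulrA.
- by move=> *; rewrite mul1r.
- by move=> *; rewrite mulr1.
- by move=> *; rewrite mulrDl.
- by move=> *; rewrite mulrDr.
- by move=> *; rewrite scalerAl.
- by move=> *; rewrite scalerAr.
Qed.

Lemma hecke_mulA : associative hecke_mul.
Proof.
elim/quotW=> x; elim/quotW=> y; elim/quotW=> z;
  rewrite (pi_hmul y z) (pi_hmul x y) !pi_hmul.
by apply: hecke_eq; apply: hc_mulA.
Qed.
Lemma hecke_mul1l : left_id (\pi_hecke HOne) hecke_mul.
Proof.
by elim/quotW=> x;
  rewrite pi_hmul;
  apply: hecke_eq; apply: hc_mul1l.
Qed.
Lemma hecke_mul1r : right_id (\pi_hecke HOne) hecke_mul.
Proof.
by elim/quotW=> x;
  rewrite pi_hmul;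
  apply: hecke_eq; apply: hc_mul1r.
Qed.
Lemma hecke_mulDl : left_distributive hecke_mul hecke_add.
Proof.
elim/quotW=> x; elim/quotW=> y; elim/quotW=> z;
  rewrite (pi_hadd x y) (pi_hmul x z) (pi_hmul y z) pi_hmul pi_hadd.
by apply: hecke_eq; apply: hc_mulDl.
Qed.
Lemma hecke_mulDr : right_distributive hecke_mul hecke_add.
Proof.
elim/quotW=> x; elim/quotW=> y; elim/quotW=> z;
  rewrite (pi_hadd y z) (pi_hmul x y) (pi_hmul x z) pi_hmul pi_hadd.
by apply: hecke_eq; apply: hc_mulDr.
Qed.
Lemma hecke_one_neq0 : \pi_hecke HOne != 0.
Proof.
apply/negP=> /heckeP c10.
pose M : 'M[R]_2 :=
  \matrix_(i, j) if i == 0 then (if j == 0 then Q else 1) else (j == 0)%:R.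
have MM : M * M = Q *: M + 1.
  apply/matrixP=> i j; rewrite !mxE !big_ord_recl big_ord0 !mxE.
  case: i => [[|[|//]] ?]; case: j => [[|[|//]] ?];
    by rewrite /= ?(mul1r, mulr1, mul0r, mulr0, addr0, add0r).
have := hterm_eval_cong (a := fun=> M : 'M[R]_2) (fun _ _ _ => erefl)
  (fun _ _ _ => erefl) (fun=> MM) c10.
by move/eqP; rewrite /= oner_eq0.
Qed.

HB.instance Definition _ :=
  GRing.Zmodule_isNzRing.Build hecke hecke_mulA hecke_mul1l hecke_mul1r
    hecke_mulDl hecke_mulDr hecke_one_neq0.

Lemma hecke_scaleA a b x :
  hecke_scale a (hecke_scale b x) = hecke_scale (a * b) x.
Proof.
by elim/quotW: x => x;
  rewrite (pi_hscale b x) !pi_hscale;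
  apply: hecke_eq; apply: hc_scaleA.
Qed.
Lemma hecke_scale1 : left_id 1 hecke_scale.
Proof.
by elim/quotW=> x;
  rewrite pi_hscale;
  apply: hecke_eq; apply: hc_scale1.
Qed.
Lemma hecke_scaleDr : right_distributive hecke_scale +%R.
Proof.
move=> a; elim/quotW=> x; elim/quotW=> y.
rewrite /GRing.add /= (pi_hadd x y) (pi_hscale a x) (pi_hscale a y) pi_hscale pi_hadd;
  apply: hecke_eq;
  apply: hc_scaleDr.
Qed.
Lemma hecke_scaleDl x : {morph hecke_scale^~ x : a b / a + b}.
Proof.
elim/quotW: x => x a b /=.
rewrite {2}/GRing.add /= (pi_hscale a x) (pi_hscale b x) pi_hscale pi_hadd;
  apply: hecke_eq; apply: hc_scaleDl.
Qed.

HB.instance Definition _ :=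
  GRing.Zmodule_isLmodule.Build R hecke
    hecke_scaleA hecke_scale1 hecke_scaleDr hecke_scaleDl.

Lemma hecke_scaleAl (a : R) (x y : hecke) : a *: (x * y) = (a *: x) * y.
Proof.
elim/quotW: x => x; elim/quotW: y => y.
rewrite /GRing.scale /GRing.mul /= (pi_hmul x y) (pi_hscale a x) pi_hscale pi_hmul;
  apply: hecke_eq;
  apply: hc_scaleAl.
Qed.
HB.instance Definition _ :=
  GRing.Lmodule_isLalgebra.Build R hecke hecke_scaleAl.

Lemma hecke_scaleAr (a : R) (x y : hecke) : a *: (x * y) = x * (a *: y).
Proof.
elim/quotW: x => x; elim/quotW: y => y.
rewrite /GRing.scale /GRing.mul /= (pi_hmul x y) (pi_hscale a y) pi_hscale pi_hmul;
  apply: hecke_eq;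
  apply: hc_scaleAr.
Qed.
HB.instance Definition _ :=
  GRing.Lalgebra_isAlgebra.Build R hecke hecke_scaleAr.

Definition hgen (i : 'I_n.-1) : hecke := \pi_hecke (HGen i).

End HeckeAlgebra.

(* 'S_n composes permutations from left to right. The opposite convention     *)
(* amounts to transporting along w |-> w^-1, which fixes the simple           *)
(* transpositions and preserves lengths, cycle types and Young subgroups.     *)

Section Permutations.

Variable n : nat.

Lemma simple_subproof (i : 'I_n.-1) : (i.+1 < n)%N.
Proof. by rewrite -ltn_predRL. Qed.

Definition simple_tperm (i : 'I_n.-1) : 'S_n :=
  tperm (widen_ord (leq_pred n) i) (Ordinal (simple_subproof i)).

Definition word_perm (s : seq 'I_n.-1) : 'S_n :=
  (\prod_(i <- s) simple_tperm i)%g.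

Lemma word_perm_tperm (i j : 'I_n) : exists s, tperm i j = word_perm s.
Proof.
wlog ltij : i j / (i < j)%N.
  move=> H; case: (ltngtP i j) => [|?|/val_inj ->]; first exact: H.
    by rewrite tpermC; apply: H.
  by exists [::]; rewrite tperm1 /word_perm big_nil.
case: j ltij => j ltjn /= ltij.
elim: j => // j IHj in ltjn ltij *.
have ltj : (j < n.-1)%N by rewrite ltn_predRL.
have s1 : word_perm [:: Ordinal ltj] = simple_tperm (Ordinal ltj).
  by rewrite /word_perm big_seq1.
have [eqij | neqij] := eqVneq (i : nat) j.
  exists [:: Ordinal ltj]; rewrite s1 /simple_tperm.
  by congr tperm; apply: val_inj.
have ltij' : (i < j)%N by rewrite ltn_neqAle neqij -ltnS.
have [s Es] := IHj (ltnW ltjn) ltij'.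
exists (Ordinal ltj :: s ++ [:: Ordinal ltj]).
rewrite /word_perm big_cons big_cat /= -!/(word_perm _) -Es s1.
have <- : (tperm i (Ordinal (ltnW ltjn)) ^ simple_tperm (Ordinal ltj))%g
          = tperm i (Ordinal ltjn).
  rewrite tpermJ; congr tperm; rewrite /simple_tperm.
    by rewrite tpermD // -val_eqE /= eq_sym // neq_ltn (ltn_trans ltij').
  by rewrite (_ : widen_ord _ _ = Ordinal (ltnW ltjn)) ?tpermL;
    apply: val_inj.
by rewrite conjgE tpermV.
Qed.

Lemma word_perm_surj (w : 'S_n) :
  exists k, [exists t : k.-tuple 'I_n.-1, word_perm t == w].
Proof.
suff [s Es] : exists s, w = word_perm s.
  by exists (size s); apply/existsP; exists (in_tuple s); rewrite Es.
have [ts -> _] := prod_tpermP w; elim: ts => [|[i j] ts [s IH]].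
  by exists [::]; rewrite /word_perm !big_nil.
have [s' E'] := word_perm_tperm i j.
by exists (s' ++ s); rewrite big_cons IH /= E' /word_perm big_cat.
Qed.

Definition plength (w : 'S_n) : nat := ex_minn (word_perm_surj w).

Lemma reduced_word_ex (w : 'S_n) :
  exists t : (plength w).-tuple 'I_n.-1, word_perm t == w.
Proof. by rewrite /plength; case: ex_minnP => k /existsP. Qed.

(* The element hecke_T w below does not depend on this choice (Matsumoto). *)
Definition reduced_word (w : 'S_n) : seq 'I_n.-1 :=
  xchoose (reduced_word_ex w).

Definition min_in_class (w : 'S_n) : bool :=
  [forall v in (w ^: [set: 'S_n])%g, (plength w <= plength v)%N].

Definition cycle_type (w : 'S_n) : seq nat :=
  sort geq [seq #|A| | A : {set 'I_n} <- enum (porbits w)].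

(* [reshape_index I k] is the index of the block of I containing k. *)
Definition young (I : seq nat) : {set 'S_n} :=
  [set w : 'S_n | [forall k, reshape_index I (w k) == reshape_index I k]].

Definition young_longest (I : seq nat) : 'S_n :=
  [arg max_(w > 1%g in young I) plength w].

Definition min_coset_reps (I : seq nat) : {set 'S_n} :=
  [set w : 'S_n | [forall u in young I, (plength w <= plength (w * u)%g)%N]].

End Permutations.

Section Partitions.

Variable n : nat.

Record intpart : predArgType := IntPart {
  parts :> seq nat;
  _ : [&& sorted geq parts, 0%N \notin parts & sumn parts == n] }.

HB.instance Definition _ := [isSub for parts].
HB.instance Definition _ := [Countable of intpart by <:].

Lemma intpart_bounds (s : seq nat) :
  0%N \notin s -> (size s <= sumn s)%N /\ all (fun p => p < (sumn s).+1)%N s.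
Proof.
elim: s => //= p s IHs; rewrite inE negb_or => /andP[p0 /IHs [sz le_s]].
split; first by rewrite -add1n leq_add // lt0n eq_sym.
rewrite ltnS leq_addr /=; apply: sub_all le_s => k /leq_trans; apply.
by rewrite ltnS leq_addl.
Qed.

Definition intpart_code (p : intpart) : {bseq n of 'I_n.+1} :=
  insubd [bseq] [seq inord k | k <- parts p].

Definition intpart_decode (b : {bseq n of 'I_n.+1}) : option intpart :=
  insub [seq val k | k <- (b : seq 'I_n.+1)].

Lemma intpart_codeK : pcancel intpart_code intpart_decode.
Proof.
case=> s sP; rewrite /intpart_decode /intpart_code /=.
have /and3P[_ s0 /eqP sn] := sP; have [sz les] := intpart_bounds s0.
rewrite insubdK; last by rewrite unfold_in size_map -sn.
have -> : [seq val k | k <- [seq inord k : 'I_n.+1 | k <- s]] = s.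
  rewrite -map_comp -[RHS]map_id; apply/eq_in_map => k ks /=.
  by rewrite inordK // -sn; apply: (allP les).
by case: insubP => [u _ us | /negP[]] //; congr Some; apply: val_inj.
Qed.

HB.instance Definition _ : isFinite intpart := PCanIsFinite intpart_codeK.

End Partitions.

Section SymmetricFunctions.

(* Symmetric functions are handled through their restrictions to k variables, *)
(* for every k.                                                               *)

Definition complete_sym (k r : nat) : {mpoly int[k]} :=
  \sum_(a : 'X_{1..k < r.+1} | mdeg a == r) 'X_[a].

Definition complete_syms (k : nat) (lam : seq nat) : {mpoly int[k]} :=
  \prod_(r <- lam) complete_sym k r.

Definition monomial_sym (k : nat) (mu : seq nat) : {mpoly int[k]} :=
  \sum_(a : 'X_{1..k < (sumn mu).+1} |
        sort geq [seq x <- (a : 'X_{1..k}) | x != 0%N] == mu) 'X_[a].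

Definition is_H2M (n : nat) (M : {ffun intpart n * intpart n -> int}) : Prop :=
  forall (k : nat) (lam : intpart n),
    complete_syms k lam =
      \sum_(mu : intpart n) M (lam, mu) *: monomial_sym k mu.

Definition H2M (n : nat) (lam mu : intpart n) : int :=
  xget [ffun=> 0] (@is_H2M n) (lam, mu).

End SymmetricFunctions.

Definition is_central (A : pzRingType) (z : A) : Prop :=
  forall x : A, GRing.comm z x.

Definition is_basis (R : pzRingType) (V : lmodType R) (I : finType)
    (P : V -> Prop) (v : I -> V) : Prop :=
  (forall i, P (v i)) /\
  (forall x, P x -> exists! c : {ffun I -> R}, x = \sum_i c i *: v i).

Section HeckeElements.

Variables (R : comNzRingType) (n : nat) (Q : R).

Definition hecke_T (w : 'S_n) : hecke n Q :=
  \prod_(i <- reduced_word w) hgen Q i.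

(* The formula makes sense on the whole algebra; it is the normalization map  *)
(* on the span of the T_w, w in the Young subgroup of I.                      *)
Definition normalization (I : seq nat) (h : hecke n Q) : hecke n Q :=
  \sum_(w in min_coset_reps n I) hecke_T w * h * hecke_T (w^-1)%g.

End HeckeElements.

(* Over Z[Q], with Q = 'X in {poly int}; the Geck--Rouquier element is        *)
(* recorded by its coordinates c on the T_w. It exists and is unique, so that *)
(* xget picks it below.                                                       *)
Definition is_geck_rouquier (n : nat) (lam : intpart n)
    (c : {ffun 'S_n -> {poly int}}) : Prop :=
  [/\ is_central (\sum_(w : 'S_n) c w *: hecke_T 'X w),
      forall w, (c w).[0] = (cycle_type w == lam)%:R
    & forall w, min_in_class w -> c w - (cycle_type w == lam)%:R = 0].

Definition geck_rouquier_coef (n : nat) (lam : intpart n) :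
    {ffun 'S_n -> {poly int}} :=
  xget [ffun=> 0] (@is_geck_rouquier n lam).

Definition geck_rouquier (R : comNzRingType) (n : nat) (Q : R)
    (lam : intpart n) : hecke n Q :=
  \sum_(w : 'S_n)
    (map_poly intr (geck_rouquier_coef lam w)).[Q] *: hecke_T Q w.

(* Main.v *)
(* Since [T_d T_omega = T_(d omega)] for [d] minimal in [d S_lambda], the          *)
(* normalization of [T_omega ^ 2] is the sum of the [T_x T_(x^-1)], where [x] runs *)
(* over the longest elements of the cosets [x S_lambda]; it is central. As the     *)
(* [T_w] are orthonormal for a form for which generators are self-adjoint, the     *)
(* coefficient of [T_c] in [T_x T_(x^-1)] is that of [T_x] in [T_c T_x]. When [c]   *)
(* is the product of the simple transpositions of [S_mu], this is [Q ^ (n - l(mu))] *)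
(* if all of them are descents of [x], and 0 otherwise. Hence the coefficient of   *)
(* the normalization at [c] is [Q ^ (n - l(mu))] times the number of double cosets  *)
(* of [S_mu] and [S_lambda], which counts the contingency tables with margins      *)
(* lambda and mu, i.e. H2M[lambda, mu].                                            *)
(* Cyclic shifts that do not increase the length bring every permutation to such   *)
(* an element [c], so that a central element is determined by one coefficient for  *)
(* each partition; for [Gamma_mu] these coefficients are 0 and 1. The matrix H2M   *)
(* is invertible over the rationals: up to scaling it is the Gram matrix of the    *)
(* permutation characters on the cosets of the Young subgroups, and their values   *)
(* at the elements [c] form a triangular matrix.                                   *)

Require Import Defs.
From mathcomp Require Import all_boot all_order all_algebra all_fingroup.
From mathcomp Require Import generic_quotient fraction mpoly.
From mathcomp Require Import zify ring.
From mathcomp Require classical_sets.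

Set Implicit Arguments.
Unset Strict Implicit.
Unset Printing Implicit Defensive.

Import GRing.Theory Num.Theory.

(** By [cyclic_shift_ind], cyclic shifts bring every permutation to a Coxeter element [cox I] of a
    Young subgroup. Each step expresses the coefficient of a central element at w through the one at
    [s_ i * (w * s_ i)] and, if the length drops, the one at [w * s_ i] ([central_coefs_shift]). The
    coefficient at [cox I] does not depend on the order of the parts of I ([central_coef_cox]).
    Hence central elements that agree at all [cox mu] are equal ([central_eq]).

    Both sides of the formula are compared there. Since [cox mu] has minimal length in its class,
    the Geck-Rouquier elements have coefficients 0 and 1 ([coef_geck_rouquier_cox]). The
    normalization is a central sum of products T_x T_(x^-1) ([normalization_longest],
    [long_sum_central]); as generators are self-adjoint, its coefficient is Q^(n - l(mu)) times a
    number of double cosets ([coef_norm]). Double cosets correspond to contingency tables, which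
    also give the coefficients of products of complete functions ([card_tables], [H2M_double_long]).

    For the basis, the matrix of double coset numbers is, up to scaling rows and columns, a Gram
    matrix of permutation characters, which are independent by triangularity
    ([double_long_nondegenerate]). As Q is invertible, any prescribed coefficients at the [cox mu]
    are attained by exactly one combination of normalizations ([norm_span], [norm_free]). The same
    fact over a field of rational functions provides the Geck-Rouquier elements
    ([geck_rouquier_exists]). *)

Local Notation s_ := (@simple_tperm _).

(** * Length and descents of permutations *)

Section SymmetricGroup.

Variable n : nat.
Implicit Types (w u x y : 'S_n) (i j : 'I_n.-1) (k l : 'I_n).

Definition lo i : 'I_n := widen_ord (leq_pred n) i.
Definition hi i : 'I_n := Ordinal (simple_subproof i).

Lemma simple_lo i : s_ i (lo i) = hi i. Proof. exact: tpermL. Qed.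
Lemma simple_hi i : s_ i (hi i) = lo i. Proof. exact: tpermR. Qed.

Lemma simple_val i k :
  s_ i k = (if k == i :> nat then i.+1
            else if k == i.+1 :> nat then i : nat else k) :> nat.
Proof.
rewrite /simple_tperm permE /= -!val_eqE /=.
by case: ifP => // _; case: ifP.
Qed.

Lemma simple_id i k : k != i :> nat -> k != i.+1 :> nat -> s_ i k = k.
Proof.
by move=> /negPf ki /negPf ki1; apply: val_inj; rewrite /= simple_val ki ki1.
Qed.

Lemma simple_mulK i w : (s_ i * (s_ i * w))%g = w.
Proof. by rewrite mulgA tperm2 mul1g. Qed.

Lemma mul_simpleK i w : (w * s_ i * s_ i)%g = w.
Proof. by rewrite -mulgA tperm2 mulg1. Qed.

Lemma simpleV i : (s_ i)^-1%g = s_ i. Proof. exact: tpermV. Qed.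

Lemma mul_simpleV i w : (w * s_ i)^-1%g = (s_ i * w^-1)%g.
Proof. by rewrite invMg simpleV. Qed.

Lemma simple_mulV i w : (s_ i * w)^-1%g = (w^-1 * s_ i)%g.
Proof. by rewrite invMg simpleV. Qed.

(* Products in ['S_n] are read from left to right, so [descent w i] means that *)
(* [s_i * w] is shorter than [w].                                              *)
Definition descent w i : bool := w (hi i) < w (lo i).

Lemma perm_neq w i : w (hi i) != w (lo i) :> nat.
Proof. by apply/eqP=> /val_inj /perm_inj /(congr1 val) /=; lia. Qed.

Lemma descentN w i : ~~ descent w i = (w (lo i) < w (hi i)).
Proof. by have := perm_neq w i; rewrite /descent; lia. Qed.

Lemma descent_simple w i : descent (s_ i * w) i = ~~ descent w i.
Proof. by rewrite descentN /descent !permM simple_lo simple_hi. Qed.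

Definition inversions w : {set 'I_n * 'I_n} :=
  [set p : 'I_n * 'I_n | (p.1 < p.2) && (w p.2 < w p.1)].

(** Exchanging the positions i and i + 1 matches the inversions of w with those of [s_ i * w] other
    than the new one, (i, i + 1). *)
Lemma card_inversions_simple w i :
  ~~ descent w i -> #|inversions (s_ i * w)| = #|inversions w|.+1.
Proof.
move=> ndes; pose p := (lo i, hi i).
pose f := fun q : 'I_n * 'I_n => (s_ i q.1, s_ i q.2).
have fK : involutive f by move=> [a b]; rewrite /f /= !tpermK.
have pin : p \in inversions (s_ i * w).
  by rewrite inE /= !permM simple_lo simple_hi leqnn -descentN.
have pnin : p \notin inversions w by rewrite inE /= leqnn.
rewrite (cardsD1 p) pin add1n; congr _.+1.
have -> : inversions w = inversions w :\ p.
  by apply/setP=> q; rewrite !inE; case: eqP => // ->; move: pnin;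
    rewrite inE => /negPf.
rewrite -(card_imset _ (inv_inj fK)); congr #|pred_of_set _|.
apply/setP=> q; rewrite -[q]fK (mem_imset _ _ (inv_inj fK)).
case: (f q) => a b {q}; rewrite !inE /f /= !permM.
have [->|ab] := eqVneq a b; first by rewrite !ltnn !andbF.
rewrite /p !xpair_eqE -!(inj_eq val_inj) /= !simple_val.
have : a != b :> nat by [].
move: (w (s_ i b) < _) => X;
  move: (nat_of_ord a) (nat_of_ord b) (nat_of_ord i) => A B I.
by case: (A =P I); case: (B =P I); case: (A =P I.+1); case: (B =P I.+1); case: X; lia.
Qed.

(** Without descents, w and its inverse are increasing, and an increasing permutation v satisfies k
    <= v k. *)
Lemma perm_no_descent w : (forall i, ~~ descent w i) -> w = 1%g.
Proof.
move=> nd.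
have homo k l : k < l -> w k < w l.
  move=> kl; have [d] : {d | l = k + d.+1 :> nat} by exists (l - k.+1); lia.
  elim: d l {kl} => [|d IHd] l El.
    have ki : k < n.-1 by have := ltn_ord l; lia.
    have := nd (Ordinal ki); rewrite descentN.
    by congr (w _ < w _); apply: val_inj => //=; lia.
  have ki : k + d.+1 < n.-1 by have := ltn_ord l; lia.
  have kn : k + d.+1 < n by lia.
  apply: (ltn_trans (IHd (Ordinal kn) erefl)).
  have := nd (Ordinal ki); rewrite descentN.
  by congr (w _ < w _); apply: val_inj => //=; lia.
have ge (v : 'S_n) : (forall k l, k < l -> v k < v l) -> forall k, k <= v k.
  move=> hv [k kn] /=; elim: k kn => //= k IHk kn.
  exact: leq_ltn_trans (IHk (ltnW kn)) (hv _ _ _).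
have homoV k l : k < l -> (w^-1 k < w^-1 l)%g.
  move=> kl; rewrite ltnNge; apply/negP;
    rewrite leq_eqVlt => /orP[/eqP/val_inj/perm_inj E|].
    by rewrite E ltnn in kl.
  by move=> /homo; rewrite !permKV; lia.
apply/permP=> k; rewrite perm1; apply: val_inj => /=; apply/eqP.
by rewrite eqn_leq ge // andbT -{2}[k](permK w) ge.
Qed.

Lemma card_inversions1 : #|inversions 1| = 0.
Proof.
by apply: eq_card0 => -[a b]; rewrite !inE /= !perm1; case: ltngtP.
Qed.

Lemma word_perm_cons i s : word_perm (i :: s) = (s_ i * word_perm s)%g.
Proof. by rewrite /word_perm big_cons. Qed.

Lemma word_perm_cat (s t : seq 'I_n.-1) :
  word_perm (s ++ t) = (word_perm s * word_perm t)%g.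
Proof. by rewrite /word_perm big_cat. Qed.

Lemma word_perm_nil : word_perm [::] = 1%g :> 'S_n.
Proof. by rewrite /word_perm big_nil. Qed.

Lemma word_perm1 i : word_perm [:: i] = s_ i.
Proof. by rewrite /word_perm big_seq1. Qed.

Lemma word_perm_rev (s : seq 'I_n.-1) : word_perm (rev s) = (word_perm s)^-1%g.
Proof.
elim: s => [|i s IHs]; first by rewrite /rev /= word_perm_nil invg1.
by rewrite rev_cons -cats1 word_perm_cat word_perm1 word_perm_cons simple_mulV IHs.
Qed.

Lemma card_inversions_le (s : seq 'I_n.-1) : #|inversions (word_perm s)| <= size s.
Proof.
elim: s => [|i s IHs]; first by rewrite /word_perm big_nil card_inversions1.
have -> : word_perm (i :: s) = (s_ i * word_perm s)%g by rewrite /word_perm big_cons.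
case: (boolP (descent (word_perm s) i)) => [des|ndes] /=.
  have := @card_inversions_simple (s_ i * word_perm s)%g i.
  by rewrite descent_simple des simple_mulK => /(_ isT) E; rewrite E in IHs;
    rewrite ltnW // ltnW.
by rewrite card_inversions_simple.
Qed.

(** Sorting by adjacent exchanges: removing a descent costs one letter and one inversion. *)
Lemma word_of_size w : exists2 s, size s = #|inversions w| & word_perm s = w.
Proof.
have [m] := ubnP #|inversions w|; elim: m w => // m IHm w.
have [i des|nd] := pickP (descent w); last first.
  exists [::]; last by rewrite /word_perm big_nil; apply/esym/perm_no_descent => i;
    rewrite nd.
  by rewrite (perm_no_descent (w := w)) ?card_inversions1 // => i; rewrite nd.
have E := @card_inversions_simple (s_ i * w)%g i.
rewrite descent_simple des simple_mulK in E; rewrite E // => /IHm [s Es Ew].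
exists (i :: s); first by rewrite /= Es.
by rewrite /word_perm big_cons -/(word_perm s) Ew simple_mulK.
Qed.

Lemma plength_inversions w : plength w = #|inversions w|.
Proof.
rewrite /plength; case: ex_minnP => m /existsP[t /eqP <-] min.
apply/eqP; rewrite eqn_leq; have := card_inversions_le t; rewrite size_tuple => ->.
rewrite andbT.
have [s <- Es] := word_of_size (word_perm t).
by apply: min; apply/existsP; exists (in_tuple s); rewrite Es.
Qed.

Lemma plength_word (s : seq 'I_n.-1) : plength (word_perm s) <= size s.
Proof. by rewrite plength_inversions card_inversions_le. Qed.

Lemma plength_up w i : ~~ descent w i -> plength (s_ i * w) = (plength w).+1.
Proof. by rewrite !plength_inversions; apply: card_inversions_simple. Qed.

Lemma plength_down w i : descent w i -> plength w = (plength (s_ i * w)%g).+1.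
Proof.
by move=> des; rewrite -{1}(simple_mulK i w) plength_up // descent_simple negbK.
Qed.

Lemma plength1 : plength (1%g : 'S_n) = 0.
Proof. by rewrite plength_inversions card_inversions1. Qed.

Lemma plengthV w : plength (w^-1)%g = plength w.
Proof.
suff le (v : 'S_n) : plength (v^-1)%g <= plength v by apply/eqP;
  rewrite eqn_leq le -{1}[w]invgK le.
have [s Es Ev] := word_of_size v; rewrite [plength v]plength_inversions -Es -Ev.
rewrite -size_rev; apply: leq_trans (plength_word _).
by rewrite word_perm_rev.
Qed.

Lemma plength_mulr_up w i :
  ~~ descent (w^-1)%g i -> plength (w * s_ i) = (plength w).+1.
Proof. by move=> nd; rewrite -plengthV mul_simpleV plength_up // plengthV. Qed.

Lemma plength_mulr_down w i :
  descent (w^-1)%g i -> plength w = (plength (w * s_ i)%g).+1.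
Proof. by move=> nd; rewrite -plengthV (plength_down nd) -mul_simpleV plengthV. Qed.

Lemma descentV_mul w i : descent ((w * s_ i)^-1)%g i = ~~ descent (w^-1)%g i.
Proof. by rewrite mul_simpleV descent_simple. Qed.

Lemma size_reduced_word w : size (reduced_word w) = plength w.
Proof.
exact: size_tuple.
Qed.

Lemma reduced_wordK w : word_perm (reduced_word w) = w.
Proof. exact: eqP (xchooseP (reduced_word_ex w)). Qed.

Definition reduced (s : seq 'I_n.-1) := plength (word_perm s) == size s.

Lemma reduced_rev (s : seq 'I_n.-1) : reduced (rev s) = reduced s.
Proof. by rewrite /reduced word_perm_rev plengthV size_rev. Qed.

Lemma reduced_cons i s :
  reduced (i :: s) = reduced s && ~~ descent (word_perm s) i.
Proof.
rewrite /reduced word_perm_cons /=; have := plength_word s.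
by case: (boolP (descent _ _)) => [/plength_down|/plength_up] ->; lia.
Qed.

Lemma reduced_reduced_word w : reduced (reduced_word w).
Proof. by rewrite /reduced reduced_wordK size_reduced_word. Qed.

Lemma simple_braid i j : i.+1 = j :> nat ->
  (s_ i * (s_ j * s_ i) = s_ j * (s_ i * s_ j))%g.
Proof.
move=> ij; apply/permP=> k; apply: val_inj; rewrite /= !permM !simple_val -!ij.
by do ?case: eqP => //=; lia.
Qed.

Lemma simple_comm i j : i.+1 < j -> (s_ i * s_ j = s_ j * s_ i)%g.
Proof.
move=> ij; apply/permP=> k; apply: val_inj; rewrite /= !permM !simple_val.
by do ?case: eqP => //=; lia.
Qed.

End SymmetricGroup.

Local Open Scope ring_scope.

(** * The standard basis of the Hecke algebra *)

Section Descents.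

Variable n : nat.
Implicit Types (w : 'S_n) (i j : 'I_n.-1).

Lemma descent_far w i j : (i.+1 < j)%N || (j.+1 < i)%N ->
  descent (s_ i * w) j = descent w j.
Proof.
by move=> ij; rewrite /descent !permM !simple_id //=; lia.
Qed.

Lemma hi_lo i j : i.+1 = j :> nat -> hi i = lo j.
Proof. by move=> ij; apply: val_inj. Qed.

(** For neighbouring i and j, descents along the coset of w under the group generated by [s_ i] and
    [s_ j] depend only on the order of three values of w. This lemma and the next three serve the
    braid relation. *)
Lemma descent_next w i j : i.+1 = j :> nat ->
  descent (s_ i * w) j = (w (hi j) < w (lo i))%N.
Proof.
move=> ij; rewrite /descent !permM -(hi_lo ij) simple_hi.
by rewrite simple_id //=; lia.
Qed.

Lemma descent_prev w i j : i.+1 = j :> nat ->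
  descent (s_ j * w) i = (w (hi j) < w (lo i))%N.
Proof.
move=> ij; rewrite /descent !permM (hi_lo ij) simple_lo.
by rewrite simple_id //=; lia.
Qed.

Lemma descent_next_prev w i j : i.+1 = j :> nat ->
  descent (s_ j * (s_ i * w)) i = descent w j.
Proof.
move=> ij; rewrite (descent_prev _ ij) /descent !permM simple_lo (hi_lo ij).
by rewrite simple_id //=; lia.
Qed.

Lemma descent_prev_next w i j : i.+1 = j :> nat ->
  descent (s_ i * (s_ j * w)) j = descent w i.
Proof.
move=> ij; rewrite (descent_next _ ij) /descent !permM simple_hi (hi_lo ij).
by rewrite [s_ _ (lo i)]simple_id //=; lia.
Qed.

End Descents.

Section HeckeBasis.

Variables (R : comNzRingType) (n : nat) (Q : R).
Implicit Types (w x y : 'S_n) (i j : 'I_n.-1) (s t : seq 'I_n.-1).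

Notation T_ := (@hgen R n Q).
Notation T := (@hecke_T R n Q).

Local Open Scope quotient_scope.

Lemma hecke_piM (t u : hterm R n.-1) :
  \pi_(hecke n Q) t * \pi_(hecke n Q) u = \pi_(hecke n Q) (HMul t u).
Proof. exact: pi_hmul. Qed.

Lemma hecke_piD (t u : hterm R n.-1) :
  \pi_(hecke n Q) t + \pi_(hecke n Q) u = \pi_(hecke n Q) (HAdd t u).
Proof. exact: pi_hadd. Qed.

Lemma hecke_piZ c (t : hterm R n.-1) : c *:
  \pi_(hecke n Q) t = \pi_(hecke n Q) (HScale c t).
Proof. exact: pi_hscale. Qed.

Lemma hgen_braid i j : i.+1 = j :> nat -> T_ i * T_ j * T_ i = T_ j * T_ i * T_ j.
Proof.
move=> ij; rewrite /hgen !hecke_piM.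
by apply: hecke_eq; apply: hc_braid.
Qed.

Lemma hgen_comm i j : (i.+1 < j)%N -> T_ i * T_ j = T_ j * T_ i.
Proof.
by move=> ij; rewrite /hgen !hecke_piM; apply: hecke_eq; apply: hc_comm.
Qed.

Lemma hgen_quad i : T_ i * T_ i = Q *: T_ i + 1.
Proof.
rewrite /hgen hecke_piM hecke_piZ (hecke_piD _ HOne).
by apply: hecke_eq; apply: hc_quad.
Qed.

Definition hword s : hecke n Q := \prod_(i <- s) T_ i.

Lemma hword_cons i s : hword (i :: s) = T_ i * hword s.
Proof. by rewrite /hword big_cons. Qed.

Lemma hword_cat s t : hword (s ++ t) = hword s * hword t.
Proof. by rewrite /hword big_cat. Qed.

Lemma reduced_descent w i : descent w i -> reduced (i :: reduced_word (s_ i * w)%g).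
Proof.
by move=> des; rewrite reduced_cons reduced_reduced_word reduced_wordK descent_simple
  negbK.
Qed.

(** Matsumoto's theorem. If the words begin with i and j, both are descents of w, so w also has
    reduced words beginning with the two sides of the braid or commutation relation between i and j;
    induction on the length replaces the given tails by theirs. *)
Lemma matsumoto s t :
  reduced s -> reduced t -> word_perm s = word_perm t -> hword s = hword t.
Proof.
have [m] := ubnP (size s); elim: m s t => // m IHm s t.
have TE w i : (plength w < m)%N -> descent w i -> T w = T_ i * T (s_ i * w)%g.
  move=> ltw des; rewrite -[RHS]hword_cons; apply: IHm;
    first by rewrite size_reduced_word.
  - exact: reduced_reduced_word.
  - exact: reduced_descent.
  - by rewrite word_perm_cons !reduced_wordK simple_mulK.
have sizeE (u : seq 'I_n.-1) : reduced u ->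
  size u = plength (word_perm u) by move=> /eqP.
case: s => [|i s].
  move=> _ _ rt E; suff -> : t = [::] by [].
  by apply: size0nil; rewrite sizeE // -E word_perm_nil plength1.
case: t => [|j t].
  by move=> _ rs _ E; have := sizeE _ rs; rewrite E word_perm_nil plength1.
rewrite /= !hword_cons ltnS => szs ris rjt E.
set w := word_perm (i :: s) in E.
have szw : (plength w <= m)%N by rewrite -(sizeE _ ris).
have desi : descent w i.
  by move: ris; rewrite /w word_perm_cons descent_simple reduced_cons => /andP[].
have desj : descent w j.
  by move: rjt; rewrite E word_perm_cons descent_simple reduced_cons => /andP[].
(* By induction the tails matter only through their permutations, so that only w, i and j remain. *)
have -> : hword s = T (s_ i * w)%g.
  move: (ris); rewrite reduced_cons => /andP[rs _].
  apply: IHm => //; first exact: reduced_reduced_word.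
  by rewrite reduced_wordK /w word_perm_cons simple_mulK.
have -> : hword t = T (s_ j * w)%g.
  move: (rjt); rewrite reduced_cons => /andP[rt _].
  apply: IHm => //; last by rewrite reduced_wordK E word_perm_cons simple_mulK.
    by have := sizeE _ rjt; rewrite -E /= => Et; rewrite (leq_trans _ szw) // -Et.
  exact: reduced_reduced_word.
clearbody w; clear szs ris rjt E s t.
have ltdes k (v : 'S_n) : (plength v <= m)%N -> descent v k ->
  (plength (s_ k * v) < m)%N.
  by move=> lev /plength_down Ek; rewrite -Ek.
wlog : i j desi desj / (i < j)%N.
  move=> wl; case: (ltngtP i j) => [|ltji|/val_inj->//]; first exact: wl.
  by rewrite (wl j i).
rewrite leq_eqVlt => /orP[/eqP|] ij.
  (* The values of w at i, i + 1, i + 2 decrease, so three letters can be stripped along either side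
     of the braid relation. *)
  have ltw : (w (hi j) < w (lo i))%N by rewrite (ltn_trans desj) // -(hi_lo ij).
  have [lti ltj] := (ltdes _ _ szw desi, ltdes _ _ szw desj).
  rewrite (TE (s_ i * w)%g j) ?(descent_next _ ij) //.
  rewrite (TE (s_ j * (s_ i * w))%g i) ?(descent_next_prev _ ij) //; last first.
    by apply: ltdes (ltnW lti) _; rewrite (descent_next _ ij).
  rewrite (TE (s_ j * w)%g i) ?(descent_prev _ ij) //.
  rewrite (TE (s_ i * (s_ j * w))%g j) ?(descent_prev_next _ ij) //; last first.
    by apply: ltdes (ltnW ltj) _; rewrite (descent_prev _ ij).
  rewrite !mulrA (hgen_braid ij); congr (_ * T _).
  by have := simple_braid ij; rewrite !mulgA => ->.
rewrite (TE (s_ i * w)%g j) ?ltdes ?descent_far ?ij //.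
rewrite (TE (s_ j * w)%g i) ?ltdes ?descent_far ?ij ?orbT //.
by rewrite !mulrA (hgen_comm ij) !mulgA (simple_comm ij).
Qed.

Lemma hword_reduced s : reduced s -> hword s = T (word_perm s).
Proof.
by move=> rs; apply: matsumoto; rewrite ?reduced_reduced_word ?reduced_wordK.
Qed.

Lemma hecke_T1 : T 1%g = 1.
Proof.
by rewrite -word_perm_nil -hword_reduced /hword ?big_nil // /reduced word_perm_nil
  plength1.
Qed.

Lemma hecke_T_cons w i : ~~ descent w i -> T_ i * T w = T (s_ i * w)%g.
Proof.
move=> nd; rewrite -[LHS]hword_cons hword_reduced ?word_perm_cons ?reduced_wordK //.
by rewrite reduced_cons reduced_reduced_word reduced_wordK.
Qed.

Lemma hgen_mulT w i :
  T_ i * T w = T (s_ i * w)%g + (if descent w i then Q else 0) *: T w.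
Proof.
case: ifPn => des; last by rewrite scale0r addr0 hecke_T_cons.
have -> : T w = T_ i * T (s_ i * w)%g.
  by rewrite hecke_T_cons ?simple_mulK // descent_simple negbK.
by rewrite mulrA hgen_quad mulrDl mul1r scalerAl addrC.
Qed.

Lemma hecke_T_rcons w i : ~~ descent (w^-1)%g i -> T w * T_ i = T (w * s_ i)%g.
Proof.
move=> nd; have -> : T w * T_ i = hword (reduced_word w ++ [:: i]).
  by rewrite hword_cat /hword big_seq1.
rewrite hword_reduced ?word_perm_cat ?word_perm1 ?reduced_wordK //.
rewrite /reduced word_perm_cat word_perm1 reduced_wordK plength_mulr_up //.
by rewrite size_cat size_reduced_word addn1.
Qed.

Lemma hecke_T_mulgen w i :
  T w * T_ i = T (w * s_ i)%g + (if descent (w^-1)%g i then Q else 0) *: T w.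
Proof.
case: ifPn => des; last by rewrite scale0r addr0 hecke_T_rcons.
have -> : T w = T (w * s_ i)%g * T_ i.
  by rewrite hecke_T_rcons ?mul_simpleK // descentV_mul negbK.
by rewrite -mulrA hgen_quad mulrDr mulr1 -scalerAr addrC.
Qed.

Notation coefs := {ffun 'S_n -> R^o}.

(* Left multiplication by [T_i] on coordinates in the (future) basis [T_w].       *)
Definition lact i (f : coefs) : coefs :=
  [ffun w => f (s_ i * w)%g + (if descent w i then Q else 0) * f w].

Lemma lactP i c (f g : coefs) : lact i (c *: f + g) = c *: lact i f + lact i g.
Proof. by apply/ffunP=> w; rewrite !ffunE /GRing.scale /=; ring. Qed.

(** The algebra is a quotient of terms: the action on coordinates is defined on terms, and
    [hterm_act_cong] shows that it respects the relations. *)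
Fixpoint hterm_act (t : hterm R n.-1) (f : coefs) : coefs :=
  match t with
  | HZero => 0
  | HOne => f
  | HGen i => lact i f
  | HAdd x y => hterm_act x f + hterm_act y f
  | HScale c x => c *: hterm_act x f
  | HMul x y => hterm_act x (hterm_act y f)
  end.

Lemma hterm_actP (t : hterm R n.-1) c (f g : coefs) :
  hterm_act t (c *: f + g) = c *: hterm_act t f + hterm_act t g.
Proof.
elim: t f g => [||i|x IHx y IHy|a x IHx|x IHx y IHy] f g /=.
- by rewrite scaler0 addr0.
- by [].
- exact: lactP.
- by rewrite IHx IHy scalerDr !addrA [_ + _ + _ *: _]addrAC.
- by rewrite IHx scalerDr !scalerA mulrC.
- by rewrite IHy IHx.
Qed.

Lemma hterm_actD (t : hterm R n.-1) (f g : coefs) :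
  hterm_act t (f + g) = hterm_act t f + hterm_act t g.
Proof. by rewrite -[f]scale1r hterm_actP !scale1r. Qed.

Lemma hterm_act0 (t : hterm R n.-1) : hterm_act t 0 = 0.
Proof. by apply: (addrI (hterm_act t 0)); rewrite -hterm_actD !addr0. Qed.

Lemma hterm_actZ (t : hterm R n.-1) c (f : coefs) : hterm_act t (c *: f) = c *:
  hterm_act t f.
Proof. by rewrite -[c *: f]addr0 hterm_actP hterm_act0 !addr0. Qed.

Lemma lact_quad i (f : coefs) : lact i (lact i f) = Q *: lact i f + f.
Proof.
apply/ffunP=> w; rewrite !ffunE /GRing.scale /= simple_mulK descent_simple.
by case: (descent w i) => /=; ring.
Qed.

Lemma lact_comm i j (f : coefs) : (i.+1 < j)%N -> lact i (lact j f) = lact j (lact i f).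
Proof.
move=> ij; apply/ffunP=> w; rewrite !ffunE !descent_far ?ij ?orbT //.
by rewrite !mulgA (simple_comm ij); ring.
Qed.

(** Only the relative order of the values of w at i, i + 1, i + 2 matters; each order leaves a
    polynomial identity in Q. *)
Lemma lact_braid i j (f : coefs) :
  i.+1 = j :> nat -> lact i (lact j (lact i f)) = lact j (lact i (lact j f)).
Proof.
move=> ij; apply/ffunP=> w; rewrite !ffunE !simple_mulK.
rewrite (descent_next_prev _ ij) (descent_prev_next _ ij) !descent_simple.
have -> : (s_ i * (s_ j * (s_ i * w)) = s_ j * (s_ i * (s_ j * w)))%g.
  by have := congr1 (fun u => u * w)%g (simple_braid ij); rewrite -!mulgA.
rewrite (descent_next _ ij) (descent_prev _ ij) /descent (hi_lo ij).
have := perm_neq w i; have := perm_neq w j; rewrite (hi_lo ij).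
have : w (hi j) != w (lo i) :> nat.
  by apply/eqP=> /val_inj /perm_inj /(congr1 val) /=; lia.
move: (nat_of_ord (w (hi j))) (nat_of_ord (w (lo j))) (nat_of_ord (w (lo i))) => a b c.
by case: (ltnP b c); case: (ltnP a b); case: (ltnP a c) => /=; try lia; move=> *; ring.
Qed.

Lemma hterm_act_cong (x y : hterm R n.-1) : hcong Q x y -> hterm_act x =1 hterm_act y.
Proof.
elim=> //=.
- by move=> ? ? _ E f; rewrite E.
- by move=> ? ? ? _ E _ E' f; rewrite E.
- by move=> ? ? ? ? _ E _ E' f; rewrite E E'.
- by move=> ? ? ? _ E f; rewrite E.
- by move=> ? ? ? ? _ E _ E' f; rewrite E' E.
- by move=> * f /=; rewrite addrA.
- by move=> * f /=; rewrite addrC.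
- by move=> * f /=; rewrite add0r.
- by move=> * f /=; rewrite scalerA.
- by move=> * f /=; rewrite scale0r.
- by move=> * f /=; rewrite scale1r.
- by move=> * f /=; rewrite scalerDr.
- by move=> * f /=; rewrite scalerDl.
- by move=> * f /=; rewrite hterm_actD.
- by move=> * f /=; rewrite hterm_actZ.
- by move=> i j ij f; apply: lact_braid.
- by move=> i j ij f; apply: lact_comm.
- by move=> i f; apply: lact_quad.
Qed.

(** Acting on the indicator of the identity yields coordinates: T_w goes to the indicator of w
    ([hvec_hword]), which makes the T_w linearly independent. *)
Definition hvec (h : hecke n Q) : coefs := hterm_act (repr h) [ffun w => (w == 1%g)%:R].

Lemma hvec_pi (t : hterm R n.-1) :
  hvec (\pi_(hecke n Q) t) = hterm_act t [ffun w => (w == 1%g)%:R].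
Proof. exact/hterm_act_cong/repr_cong. Qed.

Lemma hvecD h k : hvec (h + k) = hvec h + hvec k.
Proof. by elim/quotW: h => t; elim/quotW: k => u; rewrite hecke_piD !hvec_pi. Qed.

Lemma hvecZ c h : hvec (c *: h) = c *: hvec h.
Proof. by elim/quotW: h => t; rewrite hecke_piZ !hvec_pi. Qed.

Lemma hvec_sum (I : Type) (r : seq I) (P : pred I) (F : I -> hecke n Q) :
  hvec (\sum_(k <- r | P k) F k) = \sum_(k <- r | P k) hvec (F k).
Proof.
apply: (big_morph hvec hvecD); apply: (addrI (hvec 0)).
by rewrite -hvecD !addr0.
Qed.

Lemma hvec_hgen i h : hvec (T_ i * h) = lact i (hvec h).
Proof. by elim/quotW: h => t; rewrite /hgen hecke_piM !hvec_pi. Qed.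

Lemma hvec1 : hvec 1 = [ffun w => (w == 1%g)%:R].
Proof. exact: hvec_pi. Qed.

Lemma hvec_hword s : reduced s -> hvec (hword s) = [ffun w => (w == word_perm s)%:R].
Proof.
elim: s => [|i s IHs] rs; first by rewrite /hword big_nil hvec1 word_perm_nil.
have := rs; rewrite reduced_cons => /andP[rs' nd].
rewrite hword_cons hvec_hgen IHs //; apply/ffunP=> w.
rewrite !ffunE word_perm_cons -(can_eq (simple_mulK i)) simple_mulK.
have [->|ne] := eqVneq w (word_perm s); last by rewrite mulr0 addr0.
by rewrite (negPf nd) mul0r addr0.
Qed.

Definition coef (h : hecke n Q) w : R := hvec h w.

Lemma coefD h k w : coef (h + k) w = coef h w + coef k w.
Proof. by rewrite /coef hvecD ffunE. Qed.

Lemma coefZ a h w : coef (a *: h) w = a * coef h w.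
Proof. by rewrite /coef hvecZ ffunE. Qed.

Lemma coef_sum (I : Type) (r : seq I) (P : pred I) (F : I -> hecke n Q) w :
  coef (\sum_(k <- r | P k) F k) w = \sum_(k <- r | P k) coef (F k) w.
Proof. by rewrite /coef hvec_sum sum_ffunE. Qed.

Lemma coef_T w x : coef (T w) x = (x == w)%:R.
Proof. by rewrite /coef hvec_hword ?reduced_reduced_word // reduced_wordK ffunE. Qed.

Lemma coef_lin (c : 'S_n -> R) x : coef (\sum_w c w *: T w) x = c x.
Proof.
rewrite coef_sum (bigD1 x) //= big1 => [|w wx].
  by rewrite addr0 coefZ coef_T eqxx mulr1.
by rewrite coefZ coef_T eq_sym (negPf wx) mulr0.
Qed.

(** The span of the T_w contains 1 and is stable under left multiplication by generators, hence by
    all terms. *)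
Lemma hecke_spanned h : exists c : 'S_n -> R, h = \sum_w c w *: T w.
Proof.
pose spanned h := exists c : 'S_n -> R, h = \sum_w c w *: T w.
have spT w : spanned (T w).
  exists (fun x => (x == w)%:R); rewrite (bigD1 w) //= eqxx scale1r big1 ?addr0 //.
  by move=> x /negPf ->; rewrite scale0r.
have spD g k : spanned g -> spanned k -> spanned (g + k).
  case=> c -> [d ->]; exists (fun w => c w + d w); rewrite -big_split /=.
  by apply: eq_bigr => w _; rewrite scalerDl.
have spZ a g : spanned g -> spanned (a *: g).
  case=> c ->; exists (fun w => a * c w); rewrite scaler_sumr.
  by apply: eq_bigr => w _; rewrite scalerA.
have sp0 : spanned 0 by rewrite -(scale0r (T 1%g)); apply/spZ/spT.
have spM g : (forall w, spanned (g * T w)) -> forall k, spanned k -> spanned (g * k).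
  move=> gT _ [c ->]; rewrite mulr_sumr.
  apply: (big_ind spanned) => // w _; rewrite -scalerAr; exact: spZ.
suff H w : spanned (h * T w) by have := H 1%g; rewrite hecke_T1 mulr1.
elim/quotW: h w; elim=> [||i|t IHt u IHu|a t IHt|t IHt u IHu] w.
- by rewrite (_ : \pi_(hecke n Q) HZero = 0) // mul0r.
- by rewrite (_ : \pi_(hecke n Q) HOne = 1) // mul1r.
- by rewrite -/(T_ i) hgen_mulT; apply/spD/spZ.
- by rewrite -hecke_piD mulrDl; apply: spD.
- by rewrite -hecke_piZ -scalerAl; apply: spZ.
- by rewrite -hecke_piM -mulrA; apply: spM.
Qed.

Lemma coefK h : \sum_w coef h w *: T w = h.
Proof. by have [c ->] := hecke_spanned h; apply: eq_bigr => w _; rewrite coef_lin. Qed.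

Lemma coef_inj h k : coef h =1 coef k -> h = k.
Proof.
by move=> E; rewrite -(coefK h) -(coefK k); apply: eq_bigr => w _; rewrite E.
Qed.

Lemma coef_mulgenl i h w :
  coef (T_ i * h) w = coef h (s_ i * w)%g + (if descent w i then Q else 0) * coef h w.
Proof. by rewrite /coef hvec_hgen ffunE. Qed.

Lemma coef_mulgenr i h w :
  coef (h * T_ i) w =
  coef h (w * s_ i)%g + (if descent (w^-1)%g i then Q else 0) * coef h w.
Proof.
have [c ->] := hecke_spanned h; rewrite !coef_lin mulr_suml coef_sum.
under eq_bigr => x _ do
  rewrite -scalerAl coefZ hecke_T_mulgen coefD coefZ !coef_T mulrDr.
rewrite big_split /=; congr (_ + _).
  rewrite (bigD1 (w * s_ i)%g) //= mul_simpleK eqxx mulr1 big1 ?addr0 //.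
  move=> x ne; case: eqP => [E|]; last by rewrite mulr0.
  by rewrite E mul_simpleK eqxx in ne.
rewrite (bigD1 w) //= eqxx mulr1 mulrC big1 ?addr0 // => x ne.
by rewrite eq_sym (negPf ne) !mulr0.
Qed.

End HeckeBasis.

(** * Reduction to Coxeter elements by cyclic shifts *)

Section Compositions.

Lemma reshape_index_cons p (I : seq nat) k :
  reshape_index (p :: I) k = if (k < p)%N then 0%N else (reshape_index I (k - p)).+1.
Proof.
rewrite /reshape_index /= subn_eq0.
by have [//|lepk] := ltnP k p; rewrite subSn.
Qed.

Lemma leq_reshape_index (I : seq nat) : {homo reshape_index I : k l / (k <= l)%N}.
Proof.
elim: I => [|p I IHI] k l kl //.
rewrite !reshape_index_cons; case: ltnP => // pk.
by rewrite ifN -?leqNgt ?(leq_trans pk kl) // ltnS IHI // leq_sub2r.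
Qed.

(** A composition amounts to the choice of the neighbours a, a + 1 that share a block: the value of
    P at 0 tells whether the first part is enlarged or a new part 1 is put in front. *)
Lemma composition_of_pred n (P : pred nat) :
  exists I : seq nat, [/\ sumn I = n, 0%N \notin I &
    forall a, (a.+1 < n)%N -> P a = (reshape_index I a == reshape_index I a.+1)].
Proof.
elim: n P => [|[|n] IHn] P; [by exists [::]|by exists [:: 1%N]|].
have [[|p I] [//= sI]] := IHn (fun a => P a.+1).
rewrite inE negb_or => /andP[p0 I0] PI.
case: (boolP (P 0%N)) => P0.
  exists (p.+1 :: I); split=> [|//|[|a]]; first by rewrite /= -sI.
    by move=> _; rewrite !reshape_index_cons !ltnS P0; case: p p0 {sI PI}.
  by move=> lta; rewrite PI // !reshape_index_cons !ltnS !subSS.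
exists [:: 1%N, p & I]; split=> [||[|a]]; first by rewrite /= -sI.
- by rewrite !inE !negb_or p0 I0.
- by move=> _; rewrite (negPf P0) !reshape_index_cons.
- by move=> lta; rewrite PI // [in RHS]reshape_index_cons [in X in _ ==
  X]reshape_index_cons /= !subn1 eqSS.
Qed.

End Compositions.

Section CyclicShifts.

Variable n : nat.
Implicit Types (w u : 'S_n) (i j : 'I_n.-1) (s : seq 'I_n.-1).

(** These are the simple transpositions of the Young subgroup in increasing order; their product
    [cox I] is a Coxeter element, with the blocks of I as cycles. *)
Definition cword (I : seq nat) : seq 'I_n.-1 :=
  [seq a : 'I_n.-1 <- enum 'I_n.-1 | reshape_index I a == reshape_index I a.+1].

Definition cox (I : seq nat) : 'S_n := word_perm (cword I).

Lemma sorted_cword s :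
  sorted ltn (map val s) -> exists2 I, sumn I = n /\ 0%N \notin I & s = cword I.
Proof.
move=> srt; have [I [sI I0 PI]] := composition_of_pred n (mem (map val s)).
exists I => //; apply: (inj_map val_inj).
apply: (irr_sorted_eq ltn_trans ltnn srt).
  rewrite sorted_map; apply: (sorted_filter (leT := relpre val ltn)).
    by move=> ? ? ?; apply: ltn_trans.
  by rewrite -sorted_map val_enum_ord iota_ltn_sorted.
move=> a; apply/idP/mapP => [ai|[i]].
  have /mapP[i si ->] := ai; exists i => //.
  by rewrite mem_filter mem_enum andbT -PI //= ?map_f //; have := ltn_ord i; lia.
rewrite mem_filter => /andP[iI _] ->; have := PI i; rewrite iI /= => -> //.
by have := ltn_ord i; lia.
Qed.

Lemma word_perm_id s (k : 'I_n) : (forall j, j \in s ->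
  k != j :> nat /\ k != j.+1 :> nat) ->
  word_perm s k = k.
Proof.
elim: s => [|j s IHs] H; first by rewrite word_perm_nil perm1.
rewrite word_perm_cons permM simple_id; try by have [] := H j (mem_head _ _).
by apply: IHs => l ls; apply: H; rewrite inE ls orbT.
Qed.

Lemma simple_word_comm i s : (forall j, j \in s -> (i.+1 < j)%N) ->
  (word_perm s * s_ i = s_ i * word_perm s)%g.
Proof.
elim: s => [|j s IHs] H; first by rewrite word_perm_nil mul1g mulg1.
rewrite word_perm_cons -mulgA IHs; last by move=> l ls; apply: H; rewrite inE ls orbT.
by rewrite !mulgA -(simple_comm (H j (mem_head _ _))).
Qed.

Variable P : 'S_n -> Prop.
Hypothesis Pcox : forall I, sumn I = n -> 0%N \notin I -> P (cox I).
(** This hypothesis and the next mirror [central_coefs_shift]: conjugation by [s_ i] keeps the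
    length, or lowers it by two, and then [w * s_ i] enters as well. *)
Hypothesis Pshift : forall w i, descent (w^-1)%g i -> ~~ descent (w * s_ i)%g i ->
  P (s_ i * (w * s_ i))%g -> P w.
Hypothesis Pdrop : forall w i, descent (w^-1)%g i -> descent (w * s_ i)%g i ->
  P (s_ i * (w * s_ i))%g -> P (w * s_ i)%g -> P w.

(* Here [u] lives in ['S_m] and [s] has distinct letters, all at least m - 1.    *)
(* Write i = u (m - 1): conjugating by [s_i] increases i, and leaves [s] alone   *)
(* as long as i + 1 < m - 1; once i = m - 2, the last letter of [u] joins [s],   *)
(* and [u] is left in ['S_(m - 1)].                                               *)
Lemma cyclic_shift_ind_aux m u s :
  (forall k : 'I_n, (m <= k)%N -> u k = k) ->
  sorted ltn (map val s) -> (forall j, j \in s -> (m.-1 <= j)%N) ->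
  P (u * word_perm s)%g.
Proof.
elim: m u s => [|m IHm] u s um srt ms.
  have [I [sI I0] ->] := sorted_cword srt.
  rewrite (_ : u = 1%g) ?mul1g; first exact: Pcox.
  by apply/permP=> k; rewrite um // perm1.
have msW j : j \in s -> (m.-1 <= j)%N by move=> /ms; lia.
have [lemn|ltmn] := leqP n m.
  by apply: IHm => // k mk; apply: um; have := ltn_ord k; lia.
pose M := Ordinal ltmn.
have uM : (u M <= m)%N.
  rewrite leqNgt; apply/negP=> lt.
  by have /perm_inj E := um (u M) lt; rewrite E /= ltnn in lt.
(* Induction on the distance d from u(m) to m: for d = 0 the point m is fixed, for d = 1 the letter
   m - 1 passes from u to s, and for larger d a conjugation lowers d. *)
have [d Ed] : {d | (u M + d = m)%N} by exists (m - u M)%N; lia.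
elim: d u um {uM} Ed => [|d IHd] u um Ed.
  apply: IHm => // k; rewrite leq_eqVlt => /orP[/eqP mk|]; last exact: um.
  have -> : k = M by apply: val_inj.
  by apply: val_inj => /=; lia.
have ki : (u M < n.-1)%N by lia.
pose i := Ordinal ki.
have loi : lo i = u M by apply: val_inj.
have umi (k : 'I_n) : (m < k)%N -> (u * s_ i)%g k = k.
  by move=> mk; rewrite permM um // simple_id //=; lia.
case: d IHd Ed => [|d] IHd Ed.
  rewrite -[u](mul_simpleK i) -mulgA -word_perm_cons; apply: IHm.
  - move=> k; rewrite leq_eqVlt => /orP[/eqP mk|]; last exact: umi.
    have -> : k = M by apply: val_inj.
    by rewrite permM -loi simple_lo; apply: val_inj => /=; lia.
  - rewrite /= (path_sortedE ltn_trans) srt andbT.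
    by apply/allP=> _ /mapP[j js ->]; have := ms j js; rewrite /=; lia.
  - by move=> j; rewrite inE => /orP[/eqP -> /=|/msW//]; lia.
have comm : (word_perm s * s_ i = s_ i * word_perm s)%g.
  by apply: simple_word_comm => j js; have := ms j js; rewrite /=; lia.
have wE : (u * word_perm s * s_ i = u * s_ i * word_perm s)%g.
  by rewrite -!mulgA comm.
have siM : s_ i M = M by rewrite simple_id //=; lia.
have uiM : ((u * s_ i)%g M + d.+1 = m)%N.
  by rewrite permM -loi simple_lo /=; lia.
have siuM : ((s_ i * (u * s_ i))%g M + d.+1 = m)%N by rewrite permM siM.
have P1 : P (u * word_perm s * s_ i)%g by rewrite wE; apply: IHd.
have P2 : P (s_ i * (u * word_perm s * s_ i))%g.
  rewrite wE mulgA; apply: IHd => // k mk.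
  by rewrite permM simple_id ?umi //=; lia.
(* The value i is taken at m, the last position that u can move, so the value i + 1 is taken
   earlier. *)
have des : descent ((u * word_perm s)^-1)%g i.
  have fix_p (k : 'I_n) : (k < m)%N -> ((word_perm s)^-1)%g k = k.
    move=> km; apply: (@perm_inj _ (word_perm s)); rewrite permKV word_perm_id //.
    by move=> j js; have := ms j js => /=; lia.
  rewrite /descent invMg !permM !fix_p /=; try lia.
  rewrite loi permK /= ltnNge; apply/negP=> le.
  have E : u (u^-1 (hi i))%g = (u^-1 (hi i))%g.
    move: le; rewrite leq_eqVlt => /orP[/eqP E|]; last exact: um.
    have : (u^-1 (hi i))%g = M by apply: val_inj.
    by move=> /(congr1 u); rewrite permKV -loi => /(congr1 val) /=; lia.
  by move: le; rewrite -E permKV /=; lia.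
by case: (boolP (descent (u * word_perm s * s_ i) i)) => des2;
  [apply: Pdrop P1|apply: Pshift P2].
Qed.

Lemma cyclic_shift_ind w : P w.
Proof.
rewrite -[w]mulg1 -(@word_perm_nil n); apply: (@cyclic_shift_ind_aux n) => //.
by move=> k nk; have := ltn_ord k; lia.
Qed.

End CyclicShifts.

(** * Coefficients of central elements *)

Section CentralElements.

Variables (R : comNzRingType) (n : nat) (Q : R).
Implicit Types (w x y : 'S_n) (i j : 'I_n.-1) (s t : seq 'I_n.-1) (g h z : hecke n Q).

Notation T_ := (@hgen R n Q).
Notation T := (@hecke_T R n Q).

(** Compares the coefficients of T_w in T_i z and z T_i. As a condition on functions it can be
    transported along ring morphisms. *)
Definition central_coefs (c : 'S_n -> R) : Prop := forall w i,
  c (s_ i * w)%g + (if descent w i then Q else 0) * c w =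
  c (w * s_ i)%g + (if descent (w^-1)%g i then Q else 0) * c w.

Lemma central_gen z : (forall i, z * T_ i = T_ i * z) -> is_central z.
Proof.
move=> zT h; have [c ->] := hecke_spanned h; rewrite /GRing.comm mulr_sumr mulr_suml.
apply: eq_bigr => w _; rewrite -scalerAl -scalerAr; congr (_ *: _).
rewrite /hecke_T; elim: (reduced_word w) => [|i s IHs];
  first by rewrite big_nil mulr1 mul1r.
by rewrite big_cons mulrA zT -mulrA IHs mulrA.
Qed.

Lemma central_coefsP z : is_central z <-> central_coefs (coef z).
Proof.
split=> [cz w i|cz]; first by rewrite -coef_mulgenl -coef_mulgenr cz.
by apply: central_gen => i; apply: coef_inj => w; rewrite coef_mulgenl coef_mulgenr cz.
Qed.

Lemma central_coefs_shift (c : 'S_n -> R) w i : central_coefs c -> descent (w^-1)%g i ->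
  c w = c (s_ i * (w * s_ i))%g + (if descent (w * s_ i)%g i then Q else 0) * c (w *
    s_ i)%g.
Proof.
by move=> cc des; rewrite cc descentV_mul des mul0r addr0 mul_simpleK.
Qed.

(* The form for which the [T_w] are orthonormal: multiplication by a generator,  *)
(* on either side, is self-adjoint.                                               *)
Definition pairing g h : R := \sum_w coef g w * coef h w.

Lemma pairing_mulgenl i g h : pairing (T_ i * g) h = pairing g (T_ i * h).
Proof.
rewrite /pairing.
under eq_bigr do rewrite coef_mulgenl mulrDl; rewrite big_split /=.
under [RHS]eq_bigr do rewrite coef_mulgenl mulrDr; rewrite big_split /=.
congr (_ + _); last by apply: eq_bigr => w _; ring.
rewrite (reindex_inj (mulgI (s_ i))) /=.
by apply: eq_bigr => w _; rewrite simple_mulK.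
Qed.

Lemma pairing_mulgenr i g h : pairing (g * T_ i) h = pairing g (h * T_ i).
Proof.
rewrite /pairing.
under eq_bigr do rewrite coef_mulgenr mulrDl; rewrite big_split /=.
under [RHS]eq_bigr do rewrite coef_mulgenr mulrDr; rewrite big_split /=.
congr (_ + _); last by apply: eq_bigr => w _; ring.
rewrite (reindex_inj (mulIg (s_ i))) /=.
by apply: eq_bigr => w _; rewrite mul_simpleK.
Qed.

Lemma pairing_T z w : pairing z (T w) = coef z w.
Proof.
rewrite /pairing (bigD1 w) //= coef_T eqxx mulr1 big1 ?addr0 // => x /negPf ne.
by rewrite coef_T ne mulr0.
Qed.

Lemma pairing_central z s h : is_central z ->
  pairing z (hword Q s * h) = pairing z (h * hword Q s).
Proof.
move=> cz; elim: s h => [|i s IHs] h; first by rewrite /hword big_nil mulr1 mul1r.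
rewrite hword_cons -mulrA -pairing_mulgenl -(cz (T_ i)) pairing_mulgenr.
by rewrite -mulrA IHs -mulrA.
Qed.

(** By the quadratic relation, T_i has the inverse T_i - Q. *)
Lemma hword_inv s : exists2 h, hword Q s * h = 1 & h * hword Q s = 1.
Proof.
elim: s => [|i s [h sh hs]]; first by exists 1; rewrite /hword big_nil mulr1.
have E : T_ i * (T_ i - Q%:A) =
  1 by rewrite mulrBr hgen_quad -scalerAr mulr1 addrC addKr.
have E' : (T_ i - Q%:A) * T_ i =
  1 by rewrite mulrBl hgen_quad -scalerAl mul1r addrC addKr.
exists (h * (T_ i - Q%:A)); rewrite hword_cons.
  by rewrite -mulrA [hword _ _ * _]mulrA sh mul1r.
by rewrite -mulrA [X in h * X]mulrA E' mul1r.
Qed.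

(** Pairing with a central element is invariant under cyclic permutation of factors, so elements
    conjugate by a unit pair equally with z. *)
Lemma central_coef_conj z x y s : is_central z ->
  T x * hword Q s = hword Q s * T y -> coef z x = coef z y.
Proof.
move=> cz E; have [h sh hs] := hword_inv s.
rewrite -!pairing_T -[T x]mulr1 -sh mulrA E -mulrA pairing_central //.
by rewrite -mulrA hs mulr1.
Qed.

End CentralElements.

(** * Coxeter elements of Young subgroups *)

Section CoxeterElements.

Variable n : nat.
Implicit Types (w x y : 'S_n) (i j : 'I_n.-1) (s t : seq 'I_n.-1) (k l : 'I_n) (I J :
  seq nat).

Lemma word_perm_le s k i : i \notin s -> (word_perm s k <= i)%N = (k <= i)%N.
Proof.
elim: s k => [|j s IHs] k; first by rewrite word_perm_nil perm1.
rewrite inE negb_or => /andP[ij si]; rewrite word_perm_cons permM IHs // simple_val.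
have : i != j :> nat by [].
by case: (nat_of_ord k =P j); case: (nat_of_ord k =P j.+1); lia.
Qed.

(** A word without the letter i preserves the initial segment up to i, so putting [s_ i] in front
    creates an inversion. *)
Lemma uniq_reduced s : uniq s -> reduced s.
Proof.
elim: s => [|i s IHs]; first by rewrite /reduced word_perm_nil plength1.
rewrite /= reduced_cons => /andP[si us]; rewrite IHs // descentN.
apply: (@leq_ltn_trans i); first by rewrite word_perm_le.
by rewrite ltnNge word_perm_le //= ltnn.
Qed.

Definition same_block I i := reshape_index I (lo i) == reshape_index I (hi i).

Lemma mem_cword I i : (i \in cword n I) = same_block I i.
Proof. by rewrite mem_filter mem_enum andbT. Qed.

Lemma uniq_cword I : uniq (cword n I).
Proof. by rewrite filter_uniq ?enum_uniq. Qed.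

Lemma sorted_cword_ltn I : sorted ltn (map val (cword n I)).
Proof.
rewrite sorted_map; apply: (sorted_filter (leT := relpre val ltn)).
  by move=> ? ? ?; apply: ltn_trans.
by rewrite -sorted_map val_enum_ord iota_ltn_sorted.
Qed.

Lemma youngP I w :
  reflect (forall k, reshape_index I (w k) = reshape_index I k) (w \in young n I).
Proof. by rewrite inE; apply: (iffP forallP) => H k; apply/eqP. Qed.

Lemma simple_young I i : (s_ i \in young n I) = same_block I i.
Proof.
apply/youngP/eqP => [/(_ (lo i))|E k]; first by rewrite simple_lo.
have [->|ni] := eqVneq k (lo i); first by rewrite simple_lo.
have [->|ni'] := eqVneq k (hi i); first by rewrite simple_hi.
by rewrite simple_id.
Qed.

Lemma young1 I : 1%g \in young n I. Proof. by apply/youngP => k; rewrite perm1. Qed.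

Lemma youngM I x y : x \in young n I -> y \in young n I -> (x * y)%g \in young n I.
Proof. by move=> /youngP xI /youngP yI; apply/youngP => k; rewrite permM yI xI. Qed.

Lemma youngV I x : x \in young n I -> (x^-1)%g \in young n I.
Proof. by move=> /youngP xI; apply/youngP => k; rewrite -xI permKV. Qed.

Lemma cox_young I : cox n I \in young n I.
Proof.
rewrite /cox; have : all (same_block I) (cword n I) by apply/allP=> i;
  rewrite mem_cword.
elim: (cword n I) => [|i s IHs] /=; first by rewrite word_perm_nil young1.
by case/andP=> iI sI; rewrite word_perm_cons youngM ?simple_young ?IHs.
Qed.

Lemma cox_hi I i : same_block I i -> cox n I (hi i) = lo i.
Proof.
rewrite -mem_cword /cox => iI; have := sorted_cword_ltn I.
case/splitPr: iI => s t; rewrite map_cat /= (sorted_pairwise ltn_trans) pairwise_cat /=.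
case/and3P=> /allrelP st _ /andP[/allP ti _].
rewrite word_perm_cat word_perm_cons !permM [X in word_perm t (_ X)]word_perm_id.
  rewrite simple_hi word_perm_id // => j jt.
  by have := ti _ (map_f val jt) => /=; lia.
by move=> j js; have := st _ _ (map_f val js) (mem_head _ _) => /=; lia.
Qed.

Lemma block_end_unique I k l : reshape_index I k = reshape_index I l ->
  (forall i, lo i = k -> ~~ same_block I i) -> (forall i, lo i = l ->
    ~~ same_block I i) ->
  k = l.
Proof.
wlog kl : k l / (k <= l)%N.
  move=> wl E hk hl; case/orP: (leq_total k l) => kl; first exact: wl.
  by apply/esym/wl.
move=> E hk _; apply/val_inj/eqP; rewrite eqn_leq kl leqNgt /=; apply/negP=> ltkl.
have kn : (k < n.-1)%N by have := ltn_ord l; lia.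
have := hk (Ordinal kn) (val_inj _); rewrite /same_block /= => /(_ erefl) /negP[].
by rewrite eqn_leq leq_reshape_index //= E leq_reshape_index.
Qed.

(** Only the first index of each block is left free, and it must go to the last index of the block,
    the only value not yet taken. *)
Lemma cox_unique I w : w \in young n I ->
  (forall i, same_block I i -> w (hi i) = lo i) -> w = cox n I.
Proof.
move=> wI whi; apply/permP=> k.
have [i /andP[iI /eqP <-]|start] := pickP (fun i :
  'I_n.-1 => same_block I i && (hi i == k)).
  by rewrite whi // cox_hi.
have endP v : v \in young n I -> (forall i, same_block I i -> v (hi i) = lo i) ->
    forall i, lo i = v k -> ~~ same_block I i.
  move=> vI vhi i E; apply/negP=> iI; have := start i; rewrite iI /=.
  by rewrite -(inj_eq (@perm_inj _ v)) -E vhi // eqxx.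
apply: (@block_end_unique I); last 2 first.
- exact: endP.
- by apply: endP; [apply: cox_young|apply: cox_hi].
by rewrite (youngP _ _ wI) (youngP _ _ (cox_young I)).
Qed.

Lemma porbit_cox I k l :
  reshape_index I k = reshape_index I l -> l \in porbit (cox n I) k.
Proof.
have [d] := ubnP `|k - l|%N.
wlog kl : k l / (k <= l)%N.
  move=> wl E; case/orP: (leq_total k l) => kl; first exact: wl.
  by move=> H; rewrite porbit_sym; apply: wl => //; move: E; lia.
elim: d l kl => // d IHd l kl ld E.
have [->|ne] := eqVneq k l; first exact: porbit_id.
have ltkl : (k < l)%N by rewrite ltn_neqAle kl andbT.
have ln : (l.-1 < n.-1)%N by have := ltn_ord l; lia.
pose i := Ordinal ln; have hil : hi i = l by apply: val_inj => /=; lia.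
have Elo : reshape_index I k = reshape_index I (lo i).
  apply/eqP; rewrite eqn_leq leq_reshape_index ?E ?leq_reshape_index //=; lia.
have := IHd (lo i); rewrite -(@cox_hi I i) => [H|];
  last by rewrite /same_block -Elo E hil.
have : cox n I (hi i) \in porbit (cox n I) k.
  by apply: H; rewrite cox_hi /same_block -?Elo ?E ?hil //=; lia.
have := porbit_perm (cox n I) 1 l; rewrite expg1 => El.
by rewrite hil porbit_sym El porbit_sym.
Qed.

End CoxeterElements.

(** * Rearranging the blocks of a composition *)

Section BlockPermutations.

Variable n : nat.
Implicit Types (w x y : 'S_n) (i j : 'I_n.-1) (s t : seq 'I_n.-1) (k l : 'I_n) (I J :
  seq nat).

Lemma reshape_pos I k :
  (sumn (take (reshape_index I k) I) + reshape_offset I k = k)%N.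
Proof. exact: reshape_indexK. Qed.

(** The blocks of J are moved as intervals onto blocks of I of the same size; f records which block
    goes where. *)
Lemma block_perm I J : perm_eq J I -> sumn I = n ->
  exists y f, [/\ forall k l, f (reshape_index J k) = f (reshape_index J l) ->
                    reshape_index J k = reshape_index J l,
    forall k, reshape_index I (y k) = f (reshape_index J k)
  & forall k, reshape_offset I (y k) = reshape_offset J k].
Proof.
move=> pJI sI; have sJ : sumn J = n by rewrite -sI; apply: perm_sumn.
have [Is pIs EJ] := perm_iotaP 0%N pJI.
have uIs : uniq Is by rewrite (perm_uniq pIs) iota_uniq.
have szJ : size J = size Is by rewrite EJ size_map.
have rJ k : (reshape_index J k < size Is)%N by rewrite -szJ reshape_indexP ?sJ.
pose f := nth 0%N Is.
have lt_off k : (reshape_offset J k < nth 0%N I (f (reshape_index J k)))%N.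
  rewrite -(nth_map 0%N 0%N) ?rJ // -EJ reshape_offsetP // sJ //.
have ltn_y k : (flatten_index I (f (reshape_index J k)) (reshape_offset J k) < n)%N.
  by have := flatten_indexP (lt_off k); rewrite sI.
pose y0 k := Ordinal (ltn_y k).
have y0_index k : reshape_index I (y0 k) =
  f (reshape_index J k) by rewrite flatten_indexKl.
have y0_offset k : reshape_offset I (y0 k) =
  reshape_offset J k by rewrite flatten_indexKr.
have f_inj k l : f (reshape_index J k) = f (reshape_index J l) ->
    reshape_index J k = reshape_index J l.
  by move=> E; apply/eqP; rewrite -(nth_uniq 0%N (rJ k) (rJ l) uIs); apply/eqP.
have y0_inj : injective y0.
  move=> k l E; apply: val_inj; rewrite /= -(reshape_pos J k) -(reshape_pos J l).
  by rewrite -!y0_offset E; congr (sumn (take _ _) + _)%N; apply: f_inj;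
    rewrite -!y0_index E.
by exists (perm y0_inj), f; split=> [//|k|k]; rewrite permE.
Qed.

Lemma reshape_offset_hi I i :
  same_block I i -> reshape_offset I (hi i) = (reshape_offset I (lo i)).+1.
Proof.
move=> /eqP E; have := reshape_pos I (lo i); have := reshape_pos I (hi i).
by rewrite E /=; lia.
Qed.

Lemma cox_conj I J : perm_eq J I -> sumn I = n ->
  exists y, [/\ (cox n J ^ y = cox n I)%g
              & forall i, same_block J i -> y (hi i) = (y (lo i)).+1 :> nat].
Proof.
move=> pJI sI; have [y [f [f_inj y_index y_offset]]] := block_perm pJI sI.
exists y; split=> [|i iJ]; last first.
  rewrite -(reshape_pos I (y (lo i))) -(reshape_pos I (y (hi i))) !y_index !y_offset.
  by rewrite reshape_offset_hi // (eqP iJ) addnS.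
apply: cox_unique => [|i iI].
  apply/youngP=> k; rewrite -[k](permKV y) permJ !y_index.
  by rewrite (youngP _ _ (cox_young n J)).
set k := (y^-1 (lo i))%g; set l := (y^-1 (hi i))%g.
have [yk yl] : y k = lo i /\ y l = hi i by rewrite /k /l !permKV.
have ind : reshape_index J k = reshape_index J l.
  by apply: f_inj; rewrite -!y_index yk yl; apply/eqP.
have lk : l = k.+1 :> nat.
  rewrite -(reshape_pos J l) -(reshape_pos J k) ind -!y_offset yk yl.
  by rewrite reshape_offset_hi // addnS.
have kn : (k < n.-1)%N by have := ltn_ord l; lia.
have Ek : lo (Ordinal kn) = k by apply: val_inj.
have El : hi (Ordinal kn) = l by apply: val_inj; rewrite /= lk.
by rewrite -yl permJ -El cox_hi ?Ek // /same_block Ek El ind.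
Qed.

End BlockPermutations.

Section CentralCoxeter.

Variables (R : comNzRingType) (n : nat) (Q : R).
Implicit Types (w x y : 'S_n) (i j : 'I_n.-1) (s t : seq 'I_n.-1) (z :
  hecke n Q) (I J : seq nat).

Notation T := (@hecke_T R n Q).

Lemma hecke_T_hgen_conj y i j : y (lo i) = lo j -> y (hi i) = hi j ->
  hgen Q i * T y = T y * hgen Q j.
Proof.
move=> ylo yhi; have yE : (s_ i * y = y * s_ j)%g.
  by rewrite conjgC tpermJ -/(lo i) -/(hi i) ylo yhi.
rewrite hecke_T_cons ?hecke_T_rcons ?yE // descentN.
  by rewrite -ylo -yhi !permK.
by rewrite ylo yhi.
Qed.

(** As y sends i and i + 1 to neighbours in the same order, [s_ i * y = y * s_ j] for some j, both
    products being longer than y; so T_y passes through the word letter by letter. *)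
Lemma hword_conj y s : uniq s ->
  (forall i, i \in s -> y (hi i) = (y (lo i)).+1 :> nat) ->
  exists t, [/\ uniq t, word_perm t = (word_perm s ^ y)%g & hword Q s * T y =
    T y * hword Q t].
Proof.
move=> us ys.
have lt_y i : i \in s -> (y (lo i) < n.-1)%N.
  by move=> /ys; have := ltn_ord (y (hi i)); lia.
pose f i := insubd i (y (lo i) : nat).
have f_lo i : i \in s -> y (lo i) = lo (f i).
  by move=> si; apply: val_inj; rewrite /= insubdK //; apply: lt_y.
have f_hi i : i \in s -> y (hi i) = hi (f i).
  by move=> si; apply: val_inj; rewrite /= ys // f_lo.
exists (map f s); split.
- rewrite map_inj_in_uniq // => i j si sj /(congr1 (@lo n)).
  by rewrite -!f_lo // => /perm_inj /(congr1 val) /= /val_inj.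
- elim: s {us ys lt_y} f_lo f_hi => [|i s IHs] f_lo f_hi;
  first by rewrite !word_perm_nil conj1g.
  rewrite /= !word_perm_cons conjMg IHs => [|j js|j js]; last 2 first.
  - by rewrite f_lo // inE js orbT.
  - by rewrite f_hi // inE js orbT.
  by rewrite tpermJ -/(lo i) -/(hi i) f_lo ?f_hi ?mem_head.
elim: s {us ys lt_y} f_lo f_hi => [|i s IHs] f_lo f_hi.
  by rewrite /hword /= !big_nil mul1r mulr1.
rewrite /= !hword_cons -mulrA IHs => [|j js|j js]; last 2 first.
- by rewrite f_lo // inE js orbT.
- by rewrite f_hi // inE js orbT.
by rewrite mulrA (hecke_T_hgen_conj (j := f i)) ?mulrA // ?f_lo ?f_hi ?mem_head.
Qed.

Lemma central_coef_cox z I J : is_central z -> perm_eq J I -> sumn I = n ->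
  coef z (cox n J) = coef z (cox n I).
Proof.
move=> cz pJI sI; have [y [Ey yJ]] := cox_conj pJI sI.
have [t [ut Et Tt]] := @hword_conj y (cword n J) (uniq_cword n J) (fun i =>
  yJ i \o etrans (esym (mem_cword J i))).
apply: (@central_coef_conj _ _ _ _ _ _ (reduced_word y)) => //.
rewrite -Ey -/(cox n J) -Et -!hword_reduced ?uniq_reduced // ?uniq_cword //.
Qed.

End CentralCoxeter.

(** A neighbouring pair is inside a block or at a boundary, and a nonempty composition has one
    boundary fewer than blocks. *)
Lemma count_same_block (I : seq nat) : 0%N \notin I ->
  (count (fun a => reshape_index I a == reshape_index I a.+1) (iota 0 (sumn I).-1)
     + size I)%N = sumn I.
Proof.
elim: I => [|p I IHI] //; rewrite inE negb_or eq_sym -lt0n => /andP[p0 I0].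
pose same J a := reshape_index J a == reshape_index J a.+1.
have same0 : count (same (p :: I)) (iota 0 p.-1) = p.-1.
  rewrite -[RHS](size_iota 0); apply/eqP; rewrite -all_count; apply/allP=> a.
  by rewrite mem_iota /same !reshape_index_cons => lta; do 2 (rewrite ifT; last by lia).
have [I1|I1] := posnP (sumn I).
  have EI : I = [::] by case: I I0 I1 {IHI same0} => //= q I; rewrite inE negb_or; lia.
  by rewrite EI in same0 *; rewrite /= addn0 same0; lia.
have mid : same (p :: I) p.-1 = false.
  rewrite /same !reshape_index_cons ifT; last by lia.
  by rewrite ifF //; apply/negbTE; rewrite -leqNgt; lia.
have shift : count (same (p ::
  I)) (iota p (sumn I).-1) = count (same I) (iota 0 (sumn I).-1).
  rewrite -{2}[p]addn0 iotaDl count_map; apply: eq_count => a.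
  by rewrite /same /= !reshape_index_cons -addnS !addKn !ifF //; lia.
have -> : (sumn (p :: I)).-1 = (p.-1 + (1 + (sumn I).-1))%N by rewrite /=; lia.
rewrite !iotaD !count_cat -/(same (p :: I)) same0 add0n.
have -> : (p.-1 + 1 = p)%N by lia.
rewrite shift [count _ (iota _ 1)]/= mid /=.
by have := IHI I0; rewrite -/(same I); lia.
Qed.

(** * Cycle types and elements of minimal length *)

Section CycleTypes.

Variable n : nat.
Implicit Types (v w x y : 'S_n) (i j : 'I_n.-1) (k l : 'I_n) (I J : seq nat).

Lemma geq_total : total geq. Proof. by move=> a b; apply: leq_total. Qed.
Lemma geq_trans : transitive geq.
Proof. by move=> a b c ba ac; apply: leq_trans ac ba. Qed.
Lemma geq_anti : antisymmetric geq.
Proof. by move=> a b; rewrite andbC => /anti_leq. Qed.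

Lemma cycle_typeJ w y : cycle_type (w ^ y)%g = cycle_type w.
Proof.
have porbitJ k : porbit (w ^ y)%g (y k) = y @: porbit w k.
  apply/setP=> l; rewrite -[l](permKV y) (mem_imset _ _ (@perm_inj _ y)).
  apply/porbitP/porbitP=> -[m E]; exists m.
    by apply: (@perm_inj _ y); rewrite E -conjXg permJ.
  by rewrite -conjXg permJ -E.
have yI : injective (fun A : {set 'I_n} => y @: A) by apply/imset_inj/perm_inj.
have porbitsJ : porbits (w ^ y)%g = (fun A : {set 'I_n} => y @: A) @: porbits w.
  apply/setP=> A; apply/imsetP/imsetP=> [[k _ ->]|[_ /imsetP[k _ ->] ->]].
    exists (porbit w (y^-1 k)%g); first exact: imset_f.
    by rewrite -porbitJ permKV.
  by exists (y k); rewrite ?porbitJ.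
have E : perm_eq (enum (porbits (w ^ y)%g)) (map (fun A : {set 'I_n} => y @:
  A) (enum (porbits w))).
  apply: uniq_perm; rewrite ?(map_inj_uniq yI) ?enum_uniq // => A.
  rewrite mem_enum porbitsJ; apply/imsetP/mapP => -[B Bw ->]; exists B => //.
    by rewrite mem_enum.
  by rewrite mem_enum in Bw.
apply/(perm_sortP geq_total geq_trans geq_anti).
rewrite (perm_trans (perm_map _ E)) // -map_comp.
by rewrite (eq_map (fun A => card_imset _ (@perm_inj _ y))).
Qed.

Definition block I r : {set 'I_n} := [set k : 'I_n | reshape_index I k == r].

Lemma card_block I r : sumn I = n -> #|block I r| = nth 0%N I r.
Proof.
move=> sI; have lt_f (c : 'I_(nth 0%N I r)) : (flatten_index I r c < n)%N.
  by have := flatten_indexP (ltn_ord c); rewrite sI.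
pose f c := Ordinal (lt_f c).
have fI : injective f.
  move=> c d /(congr1 val)/(congr1 (reshape_offset I)) /=.
  by rewrite !flatten_indexKr // => /val_inj.
rewrite -[RHS]card_ord -(card_imset _ fI); apply: eq_card => k; rewrite inE.
apply/eqP/imsetP=> [E|[c _ ->]]; last by rewrite /= flatten_indexKl.
have lt_k : (reshape_offset I k < nth 0%N I r)%N by rewrite -E reshape_offsetP ?sI.
by exists (Ordinal lt_k) => //; apply: val_inj; rewrite /= -E reshape_indexK.
Qed.

Lemma cycle_type_blocks I w : sumn I = n -> 0%N \notin I -> w \in young n I ->
  (forall k l, reshape_index I k = reshape_index I l -> l \in porbit w k) ->
  cycle_type w = sort geq I.
Proof.
move=> sI I0 wI wporbit; apply/(perm_sortP geq_total geq_trans geq_anti).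
have porbitE k : porbit w k = block I (reshape_index I k).
  apply/setP=> l; rewrite inE; apply/idP/eqP => [/porbitP[m ->]|/esym];
    last exact: wporbit.
  elim: m => [|m IHm]; first by rewrite expg0 perm1.
  by rewrite expgSr permM (youngP _ _ wI).
have blockP r : (r < size I)%N -> exists k, k \in block I r.
  move=> ltr; apply/set0Pn; rewrite -card_gt0 card_block // lt0n.
  by apply: contraNneq I0 => <-; apply: mem_nth.
have -> : I = map (fun A : {set 'I_n} => #|A|) (map (block I) (iota 0 (size I))).
  rewrite -map_comp -[LHS](mkseq_nth 0%N) /mkseq.
  by apply: eq_map => r /=; rewrite card_block.
apply: perm_map; apply: uniq_perm; rewrite ?enum_uniq //.
  rewrite map_inj_in_uniq ?iota_uniq // => r r'; rewrite mem_iota => /= ltr _ E.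
  have [k kr] := blockP r ltr; have := kr; rewrite E inE => /eqP <-.
  by move: kr; rewrite inE => /eqP.
move=> A; rewrite mem_enum; apply/imsetP/mapP => [[k _ ->]|[r]].
  by exists (reshape_index I k); rewrite ?porbitE // mem_iota /= reshape_indexP ?sI.
rewrite mem_iota /= => ltr ->; have [k] := blockP r ltr.
by rewrite inE => /eqP kr; exists k => //; rewrite porbitE kr.
Qed.

Lemma cycle_type_cox I : sumn I = n -> 0%N \notin I ->
  cycle_type (cox n I) = sort geq I.
Proof.
by move=> sI I0; apply: cycle_type_blocks => //; [apply: cox_young|apply: porbit_cox].
Qed.

Lemma simple_conj w i : (s_ i * (w * s_ i) = w ^ s_ i)%g.
Proof. by rewrite conjgE simpleV. Qed.

(** Cyclic shifts are conjugations, so the cycle type is that of a Coxeter element; this is how it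
    is seen to be a partition of n. *)
Lemma cycle_type_cox_exists w :
  exists I, [/\ sumn I = n, 0%N \notin I & cycle_type w = sort geq I].
Proof.
elim/cyclic_shift_ind: w => [I sI I0|w i _ _|w i _ _].
- by exists I; rewrite cycle_type_cox.
- by rewrite simple_conj cycle_typeJ.
- by rewrite simple_conj cycle_typeJ.
Qed.

Lemma cycle_type_partP w :
  [&& sorted geq (cycle_type w), 0%N \notin cycle_type w & sumn (cycle_type w) == n].
Proof.
have [I [sI I0 ->]] := cycle_type_cox_exists w.
rewrite sort_sorted ?mem_sort ?I0; last exact: geq_total.
by rewrite (perm_sumn (s2 := I)) ?sI ?eqxx // perm_sort.
Qed.

Definition cycle_part w : intpart n := IntPart (cycle_type_partP w).

Lemma intpart_sum (p : intpart n) : sumn p = n.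
Proof. by case: p => s /= /and3P[_ _ /eqP]. Qed.

Lemma intpart_neq0 (p : intpart n) : 0%N \notin (p : seq nat).
Proof. by case: p => s /= /and3P[]. Qed.

Lemma intpart_sort (p : intpart n) : sort geq p = p.
Proof.
by case: p => s /= /and3P[srt _ _]; apply: sorted_sort => //; apply: geq_trans.
Qed.

Lemma cycle_type_intpart (p : intpart n) : cycle_type (cox n p) = p.
Proof. by rewrite cycle_type_cox ?intpart_sum ?intpart_neq0 ?intpart_sort. Qed.

Lemma size_cword I : sumn I = n -> 0%N \notin I -> (size (cword n I) + size I = n)%N.
Proof.
move=> sI I0; rewrite size_filter -[RHS]sI -(count_same_block I0) sI.
by rewrite -val_enum_ord count_map.
Qed.

Lemma plength_cox I : sumn I = n -> 0%N \notin I -> plength (cox n I) = (n - size I)%N.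
Proof.
move=> sI I0; have /eqP -> := uniq_reduced (uniq_cword n I).
by have := size_cword sI I0; lia.
Qed.

Lemma plength_cycle_type w : (n - size (cycle_type w) <= plength w)%N.
Proof.
elim/cyclic_shift_ind: w => [I sI I0|w i des ndes|w i des des'].
- by rewrite cycle_type_cox // size_sort plength_cox.
- rewrite {1}simple_conj cycle_typeJ plength_up // => H.
  by rewrite (plength_mulr_down des).
rewrite {1}simple_conj cycle_typeJ => H _; apply: leq_trans H _.
by rewrite (plength_mulr_down des) (plength_down des') leqW.
Qed.

Lemma min_in_class_cox I : sumn I = n -> 0%N \notin I -> min_in_class (cox n I).
Proof.
move=> sI I0; apply/forallP=> v; apply/implyP=> /imsetP[y _ ->].
rewrite plength_cox //; apply: leq_trans (plength_cycle_type _).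
by rewrite cycle_typeJ cycle_type_cox // size_sort.
Qed.

Lemma min_in_classJ w i : min_in_class w -> (plength (w ^ s_ i)%g <= plength w)%N ->
  plength (w ^ s_ i)%g = plength w /\ min_in_class (w ^ s_ i)%g.
Proof.
move=> /forallP min le; have minJ y : (plength w <= plength (w ^ y)%g)%N.
  by have /implyP -> := min (w ^ y)%g; rewrite // imset_f // inE.
have E : plength (w ^ s_ i)%g = plength w by apply/eqP; rewrite eqn_leq le minJ.
split=> //; apply/forallP=> v; apply/implyP=> /imsetP[y _ ->].
by rewrite -conjgM E.
Qed.

Lemma min_in_class_exists w : exists y, min_in_class (w ^ y)%g.
Proof.
have [y _ ymin] := @arg_minnP _ (1%g : 'S_n) predT (fun y => plength (w ^ y)%g) isT.
exists y; apply/forallP=> v; apply/implyP=> /imsetP[x _ ->].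
by rewrite -conjgM ymin.
Qed.

(** From an element of minimal length only length-preserving shifts can start, and these carry the
    coefficient unchanged to a Coxeter element. *)
Lemma central_coefs_min (R : comNzRingType) (Q : R) (c : 'S_n -> R) (F : seq nat -> R) :
  central_coefs Q c ->
  (forall I, sumn I = n -> 0%N \notin I -> c (cox n I) = F (cycle_type (cox n I))) ->
  forall w, min_in_class w -> c w = F (cycle_type w).
Proof.
move=> cc cF w; elim/cyclic_shift_ind: w => [I sI I0 _|w i des ndes|w i des des'].
- exact: cF.
- rewrite simple_conj => IHw minw;
  rewrite (central_coefs_shift cc des) (negPf ndes) mul0r addr0.
  rewrite simple_conj IHw ?cycle_typeJ //.
  apply: (min_in_classJ minw _).2.
  by rewrite -simple_conj plength_up // -plength_mulr_down.
move=> _ _ minw; have [|E _] := @min_in_classJ w i minw.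
  by rewrite -simple_conj (plength_mulr_down des) (plength_down des') ltnW // ltnW.
move: E; rewrite -simple_conj (plength_mulr_down des) (plength_down des'); lia.
Qed.

Lemma central_coefs_eq0 (R : comNzRingType) (Q : R) (c : 'S_n -> R) :
  central_coefs Q c ->
  (forall I, sumn I = n -> 0%N \notin I -> c (cox n I) = 0) ->
  forall w, c w = 0.
Proof.
move=> cc c0 w; elim/cyclic_shift_ind: w => [I sI I0|w i des ndes|w i des des'].
- exact: c0.
- by rewrite (central_coefs_shift cc des) (negPf ndes) mul0r addr0.
- by move=> E1 E2; rewrite (central_coefs_shift cc des) E1 E2 mulr0 addr0.
Qed.

Lemma central_eq (R : comNzRingType) (Q : R) (y z : hecke n Q) :
  is_central y -> is_central z ->
  (forall p : intpart n, coef y (cox n p) = coef z (cox n p)) -> y = z.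
Proof.
move=> cy cz E; apply/eqP; rewrite -subr_eq0; apply/eqP; apply: coef_inj.
have cB : is_central (y - z).
  by move=> x; rewrite /GRing.comm mulrBl mulrBr cy cz.
have coefB w : coef (y - z) w = coef y w - coef z w.
  by rewrite -scaleN1r coefD coefZ mulN1r.
have coef0 w : coef (0 : hecke n Q) w = 0 by rewrite -(scale0r 0) coefZ mul0r.
move=> w; rewrite coef0; apply:
  (central_coefs_eq0 ((central_coefsP _).1 cB)) => I sI I0.
have pI : perm_eq I (cycle_part (cox n I)) by rewrite /= cycle_type_cox // perm_sym
  perm_sort.
by rewrite coefB !(central_coef_cox _ pI) ?intpart_sum // E subrr.
Qed.

End CycleTypes.

(** * Normalizations of squares of longest elements *)

Section YoungSubgroups.

Variables (n : nat) (I : seq nat).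
Implicit Types (d u w x y : 'S_n) (i j : 'I_n.-1) (k l : 'I_n).

(* The shortest, respectively longest, elements of the cosets [x S_I]. *)
Definition short : {set 'S_n} :=
  [set d : 'S_n | [forall i, same_block I i ==> ~~ descent (d^-1)%g i]].

Definition long : {set 'S_n} :=
  [set x : 'S_n | [forall i, same_block I i ==> descent (x^-1)%g i]].

Lemma shortP d : reflect (forall i, same_block I i ->
  ~~ descent (d^-1)%g i) (d \in short).
Proof. by rewrite inE; apply: (iffP forallP) => H i; apply/implyP/H. Qed.

Lemma longP x : reflect (forall i, same_block I i -> descent (x^-1)%g i) (x \in long).
Proof. by rewrite inE; apply: (iffP forallP) => H i; apply/implyP/H. Qed.

Lemma young_descent u i : u \in young n I -> descent u i -> same_block I i.
Proof.
move=> /youngP uI des; rewrite /same_block eqn_leq leq_reshape_index //=.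
by rewrite -(uI (hi i)) -(uI (lo i)) leq_reshape_index // ltnW.
Qed.

Lemma block_chain (r : rel nat) (f : 'I_n -> nat) : transitive r ->
  (forall i, same_block I i -> r (f (lo i)) (f (hi i))) ->
  forall k l, (k < l)%N -> reshape_index I k = reshape_index I l -> r (f k) (f l).
Proof.
move=> r_trans r_next k l kl E; have [m] := ubnP (l - k)%N.
elim: m l kl E => // m IHm l kl E lkm.
have ln : (l.-1 < n.-1)%N by have := ltn_ord l; lia.
pose i := Ordinal ln; have hil : hi i = l by apply: val_inj => /=; lia.
have Elo : reshape_index I k = reshape_index I (lo i).
  apply/eqP; rewrite eqn_leq leq_reshape_index ?E ?leq_reshape_index //=; lia.
have rlo : r (f (lo i)) (f l) by rewrite -hil; apply: r_next;
  rewrite /same_block -Elo E hil.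
have [kE|nek] := eqVneq k (lo i); first by rewrite kE.
apply: r_trans rlo; apply: IHm => //=; last by lia.
by have : k != l.-1 :> nat by []; lia.
Qed.

Lemma short_mono d k l : d \in short -> (k < l)%N ->
  reshape_index I k = reshape_index I l -> ((d^-1)%g k < (d^-1)%g l)%N.
Proof.
move=> /shortP ds; apply: (@block_chain ltn (fun k => (d^-1)%g k));
  first exact: ltn_trans.
by move=> i /ds; rewrite descentN.
Qed.

Lemma long_mono x k l : x \in long -> (k < l)%N ->
  reshape_index I k = reshape_index I l -> ((x^-1)%g l < (x^-1)%g k)%N.
Proof.
move=> /longP xs; apply: (@block_chain (fun a b => b < a)%N (fun k => (x^-1)%g k)) =>
  //.
by move=> a b c ba ac; apply: ltn_trans ac ba.
Qed.

(** The hypothesis puts x^-1 y in the Young subgroup; a descent of it would contradict that x^-1 and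
    y^-1 decrease on every block. *)
Lemma long_inj x y : x \in long -> y \in long ->
  (forall k, reshape_index I (x k) = reshape_index I (y k)) -> x = y.
Proof.
move=> xl yl xy; apply/eqP; rewrite eq_mulVg1; apply/eqP.
have uI : (x^-1 * y)%g \in young n I.
  by apply/youngP=> k; rewrite permM -xy permKV.
apply: perm_no_descent => i; apply/negP=> des.
have iI := young_descent uI des.
have := (longP _ xl) i iI; rewrite /descent => lt_x.
move: des; rewrite /descent !permM => lt_y.
have := long_mono yl lt_y; rewrite -!xy !permKV !permK (eqP iI) => /(_ erefl).
by move=> /ltn_trans /(_ lt_x); rewrite ltnn.
Qed.

Lemma max_coset_long w :
  (forall u, u \in young n I -> (plength (w * u)%g <= plength w)%N) -> w \in long.
Proof.
move=> wmax; apply/longP=> i iI; apply/negPn/negP=> ndes.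
have := wmax (s_ i); rewrite simple_young => /(_ iI).
by rewrite plength_mulr_up // ltnn.
Qed.

Lemma young_longestP : young_longest n I \in young n I /\
  (forall u, u \in young n I -> (plength u <= plength (young_longest n I))%N).
Proof.
by rewrite /young_longest; case: arg_maxnP => [|w wI wmax]; [apply: young1|split].
Qed.

Lemma young_longest_long : young_longest n I \in long.
Proof.
by have [wI wmax] := young_longestP; apply: max_coset_long => u uI;
  rewrite wmax ?youngM.
Qed.

Lemma young_longestV : (young_longest n I)^-1%g = young_longest n I.
Proof.
have [wI wmax] := young_longestP; have wVI := youngV wI.
apply: long_inj.
- by apply: max_coset_long => u uI; rewrite plengthV wmax ?youngM.
- exact: young_longest_long.
- by move=> k; rewrite (youngP _ _ wI) (youngP _ _ wVI).
Qed.

(** The longest element reverses each block, which exchanges increasing and decreasing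
    arrangements. *)
Lemma long_mulr_longest d : (d * young_longest n I)%g \in long = (d \in short).
Proof.
set w := young_longest n I; have [/youngP wI _] := young_longestP.
have wl := young_longest_long.
apply/longP/shortP=> H i iI.
  have lt_w : (w (hi i) < w (lo i))%N.
    by have := (longP _ wl) i iI; rewrite /descent young_longestV.
  have dwl : (d * w)%g \in long by apply/longP.
  have := long_mono dwl lt_w; rewrite !wI (eqP iI) => /(_ erefl).
  by rewrite invMg !permM !permK descentN.
have ds : d \in short by apply/shortP.
rewrite /descent invMg !permM; apply: short_mono => //; last first.
  by rewrite young_longestV !wI (eqP iI).
by have := (longP _ wl) i iI.
Qed.

Variables (R : comNzRingType) (Q : R).
Notation T_ := (@hgen R n Q).
Notation T := (@hecke_T R n Q).

(** Since d^-1 increases on blocks, a letter that lengthens an element of the Young subgroup on the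
    right also lengthens its product with d. *)
Lemma short_young_mul d u : d \in short -> u \in young n I ->
  [/\ T (d * u)%g = T d * T u, T ((d * u)^-1)%g = T (u^-1)%g * T (d^-1)%g
    & plength (d * u)%g = (plength d + plength u)%N].
Proof.
move=> ds; have [m] := ubnP (plength u); elim: m u => // m IHm u lt_um uI.
have [i des|nd] := pickP (fun i => descent (u^-1)%g i); last first.
  have -> : u = 1%g by apply: invg_inj; rewrite invg1; apply: perm_no_descent => i;
    rewrite nd.
  by rewrite mulg1 invg1 hecke_T1 mulr1 mul1r plength1 addn0.
have iI := young_descent (youngV uI) des.
pose v := (u * s_ i)%g; have uE : u = (v * s_ i)%g by rewrite mul_simpleK.
have vI : v \in young n I by rewrite youngM ?simple_young.
have lenu : plength u = (plength v).+1 by rewrite (plength_mulr_down des).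
have [E1 E2 E3] : [/\ T (d * v)%g = T d * T v,
  T ((d * v)^-1)%g = T (v^-1)%g * T (d^-1)%g
    & plength (d * v)%g = (plength d + plength v)%N] by apply: IHm;
      rewrite // -ltnS -lenu.
have ndv : ~~ descent (v^-1)%g i by rewrite descentV_mul negbK.
clearbody v; have nddv : ~~ descent ((d * v)^-1)%g i.
  rewrite descentN invMg !permM; apply: short_mono => //; first by rewrite -descentN.
  by rewrite !(youngP _ _ (youngV vI)) (eqP iI).
rewrite lenu uE mulgA; split.
- by rewrite -!hecke_T_rcons // E1 mulrA.
- by rewrite !mul_simpleV -!hecke_T_cons // E2 mulrA.
- by rewrite plength_mulr_up // E3 addnS.
Qed.

Lemma min_coset_repsE : min_coset_reps n I = short.
Proof.
apply/setP=> d; apply/idP/idP=> [|ds]; rewrite inE.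
  move=> /forallP H; apply/shortP=> i iI; apply/negP=> des.
  have := H (s_ i); rewrite simple_young iI /= (plength_mulr_down des).
  by rewrite ltnn.
apply/forallP=> u; apply/implyP=> uI.
by have [_ _ ->] := short_young_mul ds uI; rewrite leq_addr.
Qed.

(** With w the longest element, an involution, T_d T_w^2 T_(d^-1) is T_x T_(x^-1) for x = dw, and d
    |-> dw maps the short elements onto the long ones. *)
Lemma normalization_longest :
  normalization I (T (young_longest n I) ^+ 2) = \sum_(x in long) T x * T (x^-1)%g.
Proof.
rewrite /normalization min_coset_repsE [RHS](reindex_inj (mulIg (young_longest n I)))
  /=.
apply: eq_big => [d|d ds]; first by rewrite long_mulr_longest.
have [wI _] := young_longestP; have [-> -> _] := short_young_mul ds wI.
by rewrite young_longestV expr2 !mulrA.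
Qed.

(* If [x] is long and [s_i x] is not, then [s_i x = x s_j] with [s_j] in [S_I],  *)
(* and [T_i T_x = T_x T_j]; the other terms are grouped in pairs [x], [s_i x].    *)
Lemma long_sum_central : is_central (\sum_(x in long) T x * T (x^-1)%g).
Proof.
pose A x := T x * T (x^-1)%g.
apply: central_gen => i; rewrite -/(A _).
rewrite (bigID (fun x => (s_ i * x)%g \in long)) /= mulrDl mulrDr; congr (_ + _);
  last first.
  rewrite mulr_suml mulr_sumr; apply: eq_bigr => x /andP[xl].
  rewrite inE => /forallPn[j]; rewrite negb_imply => /andP[jI ndes].
  have desj := (longP _ xl) j jI.
  (* Exchanging the values i and i + 1 of x^-1 reverses its order at j and j + 1, so these are its
     values there. *)
  have [xlo xhi] : (x^-1)%g (lo j) = hi i /\ (x^-1)%g (hi j) = lo i.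
    move: ndes desj; rewrite descentN simple_mulV /descent !permM !simple_val.
    move: ((x^-1)%g (lo j)) ((x^-1)%g (hi j)) => a b lt1 lt2.
    suff : a = i.+1 :> nat /\ b = i :> nat by case=> ? ?; split; apply: val_inj.
    move: lt1; case: (nat_of_ord a =P i); case: (nat_of_ord b =P i) => //=;
      case: (nat_of_ord a =P i.+1); case: (nat_of_ord b =P i.+1) => //=; lia.
  have [xhi' xlo'] : x (hi i) = lo j /\ x (lo i) = hi j by rewrite -xlo -xhi !permKV.
  have xE : (s_ i * x = x * s_ j)%g.
    by rewrite conjgC tpermJ -/(lo i) -/(hi i) xhi' xlo' tpermC.
  have desi : descent x i by rewrite /descent xhi' xlo' /=.
  have TT : T_ i * T x = T x * T_ j by rewrite hgen_mulT hecke_T_mulgen desi desj xE.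
  have TT' : T_ j * T (x^-1)%g = T (x^-1)%g * T_ i.
    rewrite hgen_mulT hecke_T_mulgen invgK desi desj.
    by rewrite -[(s_ j * _)%g]invgK simple_mulV invgK -xE simple_mulV.
  by rewrite mulrA TT -!mulrA TT'.
(* The remaining x come in pairs x, [s_ i * x]. With a = T_x and b = T_(x^-1), x being the shorter
   one, a pair contributes ab + T_i ab T_i, which commutes with T_i by the quadratic relation. *)
rewrite (bigID (fun x => descent x i)) /= addrC.
rewrite [X in _ + X](reindex_inj (mulgI (s_ i))) /=.
rewrite [X in _ + X](eq_bigl (fun x =>
  (x \in long) && ((s_ i * x)%g \in long) && ~~ descent x i)); last first.
  by move=> x; rewrite simple_mulK descent_simple [X in X && _]andbC.
rewrite -big_split /= mulr_suml mulr_sumr; apply: eq_bigr => x /andP[_ nd].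
rewrite /A simple_mulV -hecke_T_cons // -hecke_T_rcons ?invgK //.
move: (T x) (T (x^-1)%g) => a b.
rewrite mulrDl mulrDr !mulrA.
have -> : T_ i * T_ i * a * b * T_ i = Q *: (T_ i * a * b * T_ i) + a * b * T_ i.
  by rewrite hgen_quad !mulrDl mul1r -!scalerAl.
have -> : T_ i * a * b * T_ i * T_ i = Q *: (T_ i * a * b * T_ i) + T_ i * a * b.
  by rewrite -[LHS]mulrA hgen_quad mulrDr mulr1 -scalerAr.
by rewrite addrC -addrA addrCA.
Qed.

End YoungSubgroups.

Section CoefficientsAtCoxeterElements.

Variables (R : comNzRingType) (n : nat) (Q : R).
Implicit Types (w x y : 'S_n) (i j : 'I_n.-1) (s t : seq 'I_n.-1) (g h : hecke n Q).

Notation T_ := (@hgen R n Q).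
Notation T := (@hecke_T R n Q).

Lemma pairing_hwordr s g h :
  pairing (g * hword Q s) h = pairing g (h * hword Q (rev s)).
Proof.
elim/last_ind: s g h => [|s i IHs] g h; first by rewrite /rev /hword /= big_nil !mulr1.
rewrite -cats1 hword_cat mulrA /(hword Q [:: i]) big_seq1 pairing_mulgenr IHs.
by rewrite cats1 rev_rcons hword_cons mulrA.
Qed.

Lemma pairingC g h : pairing g h = pairing h g.
Proof. by apply: eq_bigr => w _; rewrite mulrC. Qed.

Lemma coef_TT x c : coef (T x * T (x^-1)%g) c = coef (T c * T x) x.
Proof.
rewrite -[LHS]pairing_T.
have -> : T (x^-1)%g = hword Q (rev (reduced_word x)).
  by rewrite hword_reduced ?reduced_rev ?reduced_reduced_word // word_perm_rev
    reduced_wordK.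
by rewrite pairing_hwordr revK pairingC pairing_T.
Qed.

(** Such a y is a subword of s times x, and a subword without the letter i preserves the positions
    up to i. *)
Lemma coef_hword_support s x y i : i \notin s -> coef (hword Q s * T x) y != 0 ->
  forall k, ((y * x^-1)%g k <= i)%N = (k <= i)%N.
Proof.
elim: s y => [|j s IHs] y; first rewrite /hword big_nil mul1r coef_T.
  have [-> _ _ k|_ _] := eqVneq y x; last by rewrite eqxx.
  by rewrite mulgV perm1.
rewrite inE negb_or => /andP[ij si]; rewrite hword_cons -mulrA coef_mulgenl.
have [E|nz _ k] := eqVneq (coef (hword Q s * T x) (s_ j * y)%g) 0.
  rewrite E add0r => nz; apply: IHs => //.
  by apply: contraNneq nz => ->; rewrite mulr0.
have := IHs _ si nz (s_ j k); rewrite -mulgA [(s_ j * _)%g _]permM tpermK => ->.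
by have := @word_perm_le n [:: j] k i; rewrite word_perm1 inE; apply.
Qed.

(* Letters of [s] being distinct, a subword of [s] fixes [x] only if it is empty. *)
Lemma coef_hword_diag s x : uniq s ->
  coef (hword Q s * T x) x = if all (descent x) s then Q ^+ size s else 0.
Proof.
elim: s => [|i s IHs]; first by rewrite /hword big_nil mul1r coef_T eqxx.
move=> /= /andP[si us]; rewrite hword_cons -mulrA coef_mulgenl IHs //.
have -> : coef (hword Q s * T x) (s_ i * x)%g = 0.
  apply/eqP/negPn/negP=> /(coef_hword_support si) /(_ (lo i)).
  by rewrite mulgK simple_lo /= leqnn ltnn.
rewrite add0r; case: (descent x i) => /=; last by rewrite mul0r.
by case: ifP => _; rewrite ?mulr0 // exprS.
Qed.

(* The longest elements of the double cosets of [S_J] and [S_I]. *)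
Definition double_long n I J :
  {set 'S_n} := [set x in long n I | (x^-1)%g \in long n J].

Lemma coef_long_sum_cox I J :
  coef (\sum_(x in long n I) T x * T (x^-1)%g) (cox n J) =
  #|double_long n I J|%:R * Q ^+ size (cword n J).
Proof.
rewrite coef_sum -sum1_card natr_sum mulr_suml.
rewrite [RHS](eq_bigl (fun x => (x \in long n I) && ((x^-1)%g \in long n J)));
  last first.
  by move=> x; rewrite inE.
rewrite big_mkcondr; apply: eq_bigr => x _; rewrite coef_TT mul1r.
rewrite -hword_reduced ?uniq_reduced ?uniq_cword // coef_hword_diag ?uniq_cword //.
congr (if _ then _ else _); apply/allP/longP; rewrite invgK => H i.
  by rewrite -mem_cword; apply: H.
by rewrite mem_cword; apply: H.
Qed.

End CoefficientsAtCoxeterElements.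

(** * Double cosets of Young subgroups *)

Section DoubleCosets.

Variable n : nat.
Implicit Types (g u v w x y z : 'S_n) (k l : 'I_n) (I J : seq nat).

(** If f k < g k, the indices in the block of k where f is at least g k all precede k; g is at least
    g k there and at k too, so the counts would differ. *)
Lemma decreasing_eq J (f g : 'I_n -> nat) :
  (forall k l, (k < l)%N -> reshape_index J k = reshape_index J l -> (f l <= f k)%N) ->
  (forall k l, (k < l)%N -> reshape_index J k = reshape_index J l -> (g l <= g k)%N) ->
  perm_eq [seq (reshape_index J l, f l) | l <- enum 'I_n] [seq (reshape_index J l,
    g l) | l <- enum 'I_n] ->
  f =1 g.
Proof.
move=> df dg /seq.permP pfg k.
wlog ltfg : f g df dg pfg / (f k < g k)%N.
  move=> wl; case: (ltngtP (f k) (g k)) => // lt; first exact: wl lt.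
  by apply/esym/wl => // a; rewrite pfg.
pose a := [pred p : nat * nat | (p.1 == reshape_index J k) && (g k <= p.2)%N].
have countE (h : 'I_n -> nat) :
  count a [seq (reshape_index J l, h l) | l <- enum 'I_n] =
    #|[set l : 'I_n | (reshape_index J l == reshape_index J k) && (g k <= h l)%N]|.
  rewrite -sum1_count big_map big_enum_cond -sum1_card /=.
  by apply: eq_bigl => l; rewrite inE.
have := pfg a; rewrite !countE => E.
suff : (#|[set l : 'I_n | (reshape_index J l == reshape_index J k) && (g k <= f l)%N]| <
        #|[set l : 'I_n | (reshape_index J l == reshape_index J k) &&
          (g k <= g l)%N]|)%N.
  by rewrite E ltnn.
apply/proper_card/properP; split; last first.
  by exists k; rewrite !inE eqxx ?leqnn //= -ltnNge.
apply/subsetP=> l; rewrite !inE => /andP[/eqP El le]; rewrite El eqxx /=.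
have [->|ne] := eqVneq l k; first by [].
case: (ltngtP l k) => [lk|kl|/val_inj E2]; first exact: dg.
  by have := df _ _ kl (esym El); lia.
by rewrite E2 eqxx in ne.
Qed.

Lemma double_longP I J x :
  reflect (x \in long n I /\ (x^-1)%g \in long n J) (x \in double_long n I J).
Proof.
apply: (iffP idP) => [|[xI xJ]]; last by rewrite [x \in double_long _ _ _]in_set xI.
by rewrite [x \in double_long _ _ _]in_set => /andP.
Qed.

Lemma double_long_decreasing I J x : x \in double_long n I J -> forall k l, (k < l)%N ->
  reshape_index J k = reshape_index J l ->
    (reshape_index I (x l) <= reshape_index I (x k))%N.
Proof.
move=> /double_longP[_ xJ] k l kl E; apply: leq_reshape_index; apply: ltnW.
by have := long_mono xJ kl E; rewrite invgK.
Qed.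

(** The multiset of pairs of blocks is the contingency table of x; reading it in decreasing order on
    each block of J recovers x. *)
Lemma double_long_inj I J x y : x \in double_long n I J -> y \in double_long n I J ->
  perm_eq [seq (reshape_index J l, reshape_index I (x l)) | l <- enum 'I_n]
          [seq (reshape_index J l, reshape_index I (y l)) | l <- enum 'I_n] -> x = y.
Proof.
move=> xl yl E; have [[xI _] [yI _]] := (double_longP _ _ _ xl, double_longP _ _ _ yl).
apply: long_inj xI yI _; apply: decreasing_eq E; exact: double_long_decreasing.
Qed.

Lemma perm_map_enum (T : eqType) (F : 'I_n -> T) u :
  perm_eq [seq F (u l) | l <- enum 'I_n] [seq F l | l <- enum 'I_n].
Proof.
rewrite (map_comp F u); apply/perm_map/uniq_perm; rewrite ?enum_uniq //.
  by rewrite map_inj_uniq ?enum_uniq //; apply: perm_inj.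
by move=> l; rewrite mem_enum; apply/mapP; exists (u^-1 l)%g; rewrite ?mem_enum ?permKV.
Qed.

Lemma double_coset_tables I J x u v : u \in young n J -> v \in young n I ->
  perm_eq [seq (reshape_index J l, reshape_index I ((u * x * v)%g l)) | l <- enum 'I_n]
          [seq (reshape_index J l, reshape_index I (x l)) | l <- enum 'I_n].
Proof.
move=> /youngP uJ /youngP vI.
rewrite (eq_map (g := (fun l => (reshape_index J l, reshape_index I (x l))) \o u)).
  exact: perm_map_enum.
by move=> l; rewrite /= !permM vI uJ.
Qed.

Lemma double_long_exists I J x :
  exists u v, [/\ u \in young n J,
    v \in young n I & (u * x * v)%g \in double_long n I J].
Proof.
pose P (p : 'S_n * 'S_n) := (p.1 \in young n J) && (p.2 \in young n I).
have P1 : P (1%g, 1%g) by rewrite /P !young1.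
have [[u v] /andP[/= uJ vI] wmax] := arg_maxnP (fun p => plength (p.1 * x * p.2)%g) P1.
exists u, v; split=> //; apply/double_longP; split; apply: max_coset_long => w wI.
  by have := wmax (u, v * w)%g; rewrite /= mulgA; apply; rewrite /P uJ youngM.
rewrite [leqRHS]plengthV -[leqLHS]plengthV invMg invgK.
have := wmax (w^-1 * u, v)%g; rewrite /= -!mulgA; apply.
by rewrite /P vI andbT youngM ?youngV.
Qed.

(** For fixed x, translating u and v turns u x v = x into membership in [double_long], which meets
    the double coset once; for fixed u and v, the map x |-> u x v is a bijection. *)
Lemma card_pairs_double_long I J :
  (\sum_x \sum_(u in young n J) \sum_(v in young n I) (u * x * v == x)%g =
   #|young n J| * (#|young n I| * #|double_long n I J|))%N.
Proof.
transitivity (\sum_x \sum_(u in young n J) \sum_(v in young n I)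
                (u * x * v \in double_long n I J)%g)%N.
  apply: eq_bigr => x _; have [u0 [v0 [u0J v0I x0]]] := double_long_exists I J x.
  rewrite [RHS](reindex_inj (mulgI u0)) /=.
  have memu u : (u0 * u \in young n J)%g = (u \in young n J).
    apply/idP/idP=> uJ; last exact: youngM.
    by rewrite -(mulKg u0 u) youngM ?youngV.
  rewrite (eq_bigl _ _ memu); apply: eq_bigr => u uJ.
  rewrite [RHS](reindex_inj (mulIg v0)) /=.
  have memv v : (v * v0 \in young n I)%g = (v \in young n I).
    apply/idP/idP=> vI; last exact: youngM.
    by rewrite -(mulgK v0 v) youngM ?youngV.
  rewrite (eq_bigl _ _ memv); apply: eq_bigr => v vI; congr nat_of_bool.
  have -> : (u0 * u * x * (v * v0) = u0 * (u * x * v) * v0)%g by rewrite !mulgA.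
  apply/eqP/idP=> [->//|y0]; apply: (mulgI u0); apply: (mulIg v0).
  apply: double_long_inj y0 x0 _.
  rewrite (permPl (double_coset_tables _ u0J v0I)) perm_sym.
  by rewrite (permPl (double_coset_tables _ u0J v0I)) perm_sym double_coset_tables.
rewrite exchange_big /= -sum1_card big_distrl /=; apply: eq_bigr => u uJ.
rewrite exchange_big /= mul1n -sum1_card big_distrl /=; apply: eq_bigr => v vI.
rewrite mul1n (reindex_inj (mulgI (u^-1)%g)) (reindex_inj (mulIg (v^-1)%g)) /=.
under eq_bigr => x _ do rewrite mulKVg mulgKV.
by rewrite -sum1_card [RHS]big_mkcond.
Qed.

Definition conj_count I g := #|[set x | (g ^ x)%g \in young n I]|.

Lemma conj_count_sum I g : conj_count I g = (\sum_x ((g ^ x)%g \in young n I))%N.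
Proof.
by rewrite /conj_count -sum1_card big_mkcond; apply: eq_bigr => x _; rewrite inE.
Qed.

(* This is n! times the inner product of the permutation characters on the     *)
(* cosets of the two Young subgroups, each scaled by the order of its subgroup. *)
Lemma sum_conj_count I J :
  (\sum_g conj_count I g * conj_count J g =
   #|'S_n| * (#|young n J| * (#|young n I| * #|double_long n I J|)))%N.
Proof.
rewrite -card_pairs_double_long.
transitivity (\sum_x \sum_y \sum_g ((g ^ x)%g \in young n I) *
  ((g ^ y)%g \in young n J))%N.
  under eq_bigr do rewrite !conj_count_sum big_distrl /=.
  rewrite exchange_big /=; apply: eq_bigr => x _.
  under eq_bigr do rewrite big_distrr /=.
  by rewrite exchange_big.
rewrite -[#|'S_n|]sum1_card big_distrl /=; apply: eq_bigr => x _.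
rewrite mul1n (reindex_inj (mulgI x)) /= (reindex_inj invg_inj) /=.
apply: eq_bigr => z _; rewrite (reindex_inj (conjg_inj (x^-1)%g)) /=.
under eq_bigr => g _ do rewrite conjgKV conjgM conjgKV.
rewrite (reindex_inj (conjg_inj z)) /= (reindex_inj invg_inj) /=.
under eq_bigr => u _ do rewrite conjgK.
rewrite [RHS]big_mkcond /=; apply: eq_bigr => u _.
have -> : (u^-1 \in young n J)%g = (u \in young n J).
  by apply/idP/idP=> /youngV; rewrite ?invgK.
case: (u \in young n J); last by rewrite muln0.
have E v : (u * z * v == z)%g = (v == (u^-1 ^ z)%g).
  by rewrite -(inj_eq (mulgI (u * z)^-1)%g) mulKg invMg conjgE mulgA.
rewrite muln1; under eq_bigr => v _ do rewrite E.
case: (boolP (_ \in _)) => inI.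
  by rewrite (bigD1 _ inI) /= eqxx big1 // => v /andP[_ /negPf ->].
by rewrite big1 // => v vI; case: eqP => // Ev; rewrite Ev (negPf inI) in vI.
Qed.

Lemma size_cycle_type w : size (cycle_type w) = #|porbits w|.
Proof. by rewrite size_sort size_map cardE. Qed.

(** Every cycle lies in a block and every block contains a cycle; if the numbers agree, cycles and
    blocks coincide. *)
Lemma young_cycle_type I w : sumn I = n -> 0%N \notin I -> w \in young n I ->
  (size I <= size (cycle_type w))%N /\
  (size (cycle_type w) = size I -> cycle_type w = sort geq I).
Proof.
move=> sI I0 wI; rewrite size_cycle_type.
have Ipos (r : 'I_(size I)) : (0 < nth 0%N I r)%N.
  by rewrite lt0n; apply: contraNneq I0 => <-; apply: mem_nth.
have lt_k (r : 'I_(size I)) : (flatten_index I r 0 < n)%N.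
  by have := flatten_indexP (Ipos r); rewrite sI.
pose first r := Ordinal (lt_k r).
have first_index r : reshape_index I (first r) = r by rewrite flatten_indexKl.
have porbit_index k l : l \in porbit w k -> reshape_index I l = reshape_index I k.
  move=> /porbitP[m ->]; elim: m => [|m IHm]; first by rewrite expg0 perm1.
  by rewrite expgSr permM (youngP _ _ wI).
have first_inj : injective (fun r => porbit w (first r)).
  move=> r r' E; apply: val_inj; rewrite /= -(first_index r) -(first_index r').
  by apply: porbit_index; rewrite -E porbit_id.
have sub : [set porbit w (first r) | r : 'I_(size I)] \subset porbits w.
  by apply/subsetP=> _ /imsetP[r _ ->]; apply: imset_f.
have card_im := card_imset predT first_inj; rewrite card_ord in card_im.
split=> [|E]; first by rewrite -card_im subset_leq_card.
apply: cycle_type_blocks => // k l kl.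
have /eqP im : [set porbit w (first r) | r : 'I_(size I)] == porbits w.
  by rewrite eqEcard sub card_im E leqnn.
have porb k' : exists r, porbit w k' = porbit w (first r).
  have : porbit w k' \in porbits w by apply: imset_f.
  by rewrite -im => /imsetP[r _ ->]; exists r.
have [[r Er] [r' Er']] := (porb k, porb l).
have Ek : reshape_index I k = r by rewrite -(first_index r); apply: porbit_index;
  rewrite -Er porbit_id.
have El : reshape_index I l = r' by rewrite -(first_index r'); apply: porbit_index;
  rewrite -Er' porbit_id.
have rr' : r = r' by apply: val_inj; rewrite /= -Ek -El.
by rewrite Er rr' -Er' porbit_id.
Qed.

Lemma conj_count_cox (lam mu : intpart n) : conj_count mu (cox n lam) != 0%N ->
  lam = mu \/ (size mu < size lam)%N.
Proof.
rewrite /conj_count -lt0n card_gt0 => /set0Pn[x]; rewrite inE => xmu.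
have [le eq] := young_cycle_type (intpart_sum mu) (intpart_neq0 mu) xmu.
rewrite cycle_typeJ cycle_type_intpart in le eq.
move: le; rewrite leq_eqVlt => /orP[/eqP E|]; [left|by right].
by apply: val_inj => /=; rewrite eq // intpart_sort.
Qed.

Lemma conj_count_diag (lam : intpart n) : (0 < conj_count lam (cox n lam))%N.
Proof. by rewrite card_gt0; apply/set0Pn; exists 1%g; rewrite inE conjg1 cox_young. Qed.

Lemma card_young_gt0 I : (0 < #|young n I|)%N.
Proof. by rewrite card_gt0; apply/set0Pn; exists 1%g; apply: young1. Qed.

Lemma double_long_nondegenerate (c : intpart n -> rat) :
  (forall mu : intpart n, \sum_(lam :
    intpart n) c lam * #|double_long n lam mu|%:R = 0) ->
  forall lam, c lam = 0.
Proof.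
move=> c0; pose G (lam : intpart n) := #|young n lam|%:R : rat.
have G0 lam : G lam != 0 by rewrite pnatr_eq0 -lt0n card_young_gt0.
pose b lam := c lam / G lam.
pose S g := \sum_lam b lam * (conj_count lam g)%:R.
(* By [sum_conj_count] this is a combination of the sums in [c0], the division by [G] absorbing the
   orders of the subgroups. *)
have S2 : \sum_(g : 'S_n) S g ^+ 2 = 0.
  transitivity (\sum_(mu : intpart n) b mu * G mu * #|'S_n|%:R *
                  \sum_(lam : intpart n) c lam * #|double_long n lam mu|%:R);
                    last first.
    by rewrite big1 // => mu _; rewrite c0 mulr0.
  transitivity (\sum_mu \sum_lam b mu * b lam *
                 \sum_(g : 'S_n) (conj_count lam g * conj_count mu g)%:R).
    under eq_bigr => g _ do rewrite expr2 {2}/S mulr_sumr.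
    rewrite exchange_big /=; apply: eq_bigr => mu _.
    under eq_bigr => g _ do rewrite /S mulr_suml.
    rewrite exchange_big /=; apply: eq_bigr => lam _.
    rewrite mulr_sumr; apply: eq_bigr => g _; rewrite natrM; ring.
  apply: eq_bigr => mu _; rewrite mulr_sumr; apply: eq_bigr => lam _.
  rewrite -natr_sum sum_conj_count !natrM -/(G lam) -/(G mu) -[in RHS](divfK (G0 lam)
    (c lam)) -/(b lam).
  ring.
have S0 g : S g = 0.
  have := @psumr_eq0P _ _ predT (fun g :
    'S_n => S g ^+ 2) (fun g _ => sqr_ge0 (S g)) S2 g isT.
  by move/eqP; rewrite sqrf_eq0 => /eqP.
have b0 lam : b lam = 0.
  apply/eqP/negPn/negP=> blam.
  (* Let mu have the fewest parts among the partitions with nonzero coefficient: by [conj_count_cox]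
     it alone contributes at [cox n mu]. *)
  have [mu bmu min] := @arg_minnP _ lam (fun nu => b nu != 0) (fun nu :
    intpart n => size nu) blam.
  have := S0 (cox n mu); rewrite /S (bigD1 mu) //= big1 ?addr0 => [/eqP|nu numu].
    by rewrite mulf_eq0 (negPf bmu) pnatr_eq0 /= eqn0Ngt conj_count_diag.
  have [->|bnu] := eqVneq (b nu) 0; first by rewrite mul0r.
  have [->|nz] := eqVneq (conj_count nu (cox n mu)) 0%N; first by rewrite mulr0.
  have [E|lt] := conj_count_cox nz; first by rewrite E eqxx in numu.
  by have := min nu bnu; rewrite leqNgt lt.
by move=> lam; rewrite -(divfK (G0 lam) (c lam)) -/(b lam) b0 mul0r.
Qed.

End DoubleCosets.

(** * Contingency tables and symmetric functions *)

Section FiberCounts.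

Variable n : nat.

Definition fcount (T : eqType) (F : 'I_n -> T) (t : T) : nat := #|[set p | F p == t]|.

Lemma fcount_count (T : eqType) (F : 'I_n ->
  T) t : fcount F t = count_mem t [seq F p | p : 'I_n <- enum 'I_n].
Proof.
rewrite -sum1_count big_map big_enum_cond -[LHS]sum1_card /=.
by apply: eq_bigl => p; rewrite inE.
Qed.

Lemma eq_fcount (T : eqType) (F G : 'I_n -> T) t : F =1 G -> fcount F t = fcount G t.
Proof. by move=> E; apply: eq_card => p; rewrite !inE E. Qed.

Lemma perm_eq_fcount (T : eqType) (F G : 'I_n -> T) :
  perm_eq [seq F p | p : 'I_n <- enum 'I_n] [seq G p | p :
    'I_n <- enum 'I_n] <-> fcount F =1 fcount G.
Proof.
split=> [/seq.permP E t|E]; first by rewrite !fcount_count E.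
by apply/allP=> t _ /=; rewrite -!fcount_count E.
Qed.

Lemma fcount_perm (T : eqType) (F G : 'I_n -> T) : fcount F =1 fcount G ->
  exists z : 'S_n, forall p : 'I_n, F p = G (z p).
Proof.
move=> /perm_eq_fcount; rewrite -[X in perm_eq _ X](_ : val [tuple G p | p < n] = _) //.
case/tuple_permP=> z E; exists z => p.
have := congr1 (fun s => nth (F p) s p) E.
rewrite (nth_map p) ?size_enum_ord // nth_ord_enum => ->.
by rewrite -tnth_nth !tnth_mktuple.
Qed.

Lemma fcount_compose (T : eqType) (F : 'I_n ->
  T) (z : 'S_n) : fcount (F \o z) =1 fcount F.
Proof. by apply/perm_eq_fcount/perm_map_enum. Qed.

Lemma fcount_proj (T : finType) (U : eqType) (F : 'I_n -> T) (h : T -> U) u :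
  fcount (h \o F) u = (\sum_(t | h t == u) fcount F t)%N.
Proof.
rewrite /fcount -sum1_card (partition_big F (fun t => h t == u)) => [|p];
  last by rewrite inE.
apply: eq_bigr => t /eqP ht; rewrite -sum1_card; apply: eq_bigl => p.
by rewrite !inE /=; have [->|] := eqVneq (F p) t; rewrite ?andbF // ht eqxx.
Qed.

Lemma fcount_exists (T : finType) (m : T -> nat) : (\sum_t m t = n)%N ->
  exists F : 'I_n -> T, fcount F =1 m.
Proof.
move=> sm; pose W := flatten [seq nseq (m t) t | t <- enum T].
have szW : size W = n.
  by rewrite size_flatten /shape -map_comp sumnE big_map big_enum -sm;
    apply: eq_bigr => t _; rewrite /= size_nseq.
have countW t : count_mem t W = m t.
  rewrite count_flatten sumnE 2!big_map big_enum (bigD1 t) //= count_nseq /= eqxx mul1n.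
  by rewrite big1 ?addn0 // => u /negPf ut; rewrite count_nseq /= ut.
exists (tnth (tcast szW (in_tuple W))) => t.
by rewrite fcount_count map_tnth_enum val_tcast countW.
Qed.

End FiberCounts.

Lemma fcount_block n I r : sumn I = n ->
  fcount (fun p : 'I_n => reshape_index I p) r = nth 0%N I r.
Proof. by move=> sI; rewrite -(card_block r sI). Qed.

Section Tables.

Variables (n k : nat) (lam mu : intpart n) (a : 'X_{1..k}).
Hypothesis n_gt0 : (0 < n)%N.
Hypothesis shape_a : sort geq [seq x <- (a : 'X_{1..k}) | x != 0%N] = mu.

Definition is_table (f : {ffun 'I_(size lam) -> 'X_{1..k < n.+1}}) : bool :=
  [forall i, mdeg (f i) == nth 0%N lam i] && ((\sum_i (f i : 'X_{1..k}))%MM == a).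

(** The nonzero exponents of a are the parts of mu in some order, so each block of mu can be
    labelled by a variable with that exponent. *)
Lemma shape_labels : exists g : 'I_n -> 'I_k,
  (forall p p', (g p == g p') = (reshape_index mu p == reshape_index mu p')) /\
  (forall c, fcount g c = a c).
Proof.
pose A := [seq c <- enum 'I_k | a c != 0%N].
have EA : [seq x <- (a : 'X_{1..k}) | x != 0%N] = [seq a c | c <- A].
  rewrite -[X in filter _ X](map_tnth_enum (a : k.-tuple nat)) filter_map.
  rewrite (@eq_filter _ _ (fun c => a c != 0%N)) => [|c /=]; last by rewrite mnm_tnth.
  by apply: eq_map => c; rewrite mnm_tnth.
have pmu : perm_eq mu [seq a c | c <- A] by rewrite -shape_a -EA perm_sort.
have [Is pIs Emu] := perm_iotaP 0%N pmu; rewrite size_map in pIs.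
have [c0 _] : exists c0, c0 \in A.
  case: A {EA} pmu pIs Emu => [|c0 A] pmu _ _; last by exists c0; rewrite mem_head.
  by move/perm_nilP: pmu => E; have := intpart_sum mu; rewrite E /=; lia.
pose S := [seq nth c0 A j | j <- Is].
have pS : perm_eq S A by rewrite -[X in perm_eq _ X](mkseq_nth c0) perm_map.
have uS : uniq S by rewrite (perm_uniq pS) filter_uniq ?enum_uniq.
have ES : mu = [seq a c | c <- S] :> seq nat.
  rewrite Emu -map_comp; apply/eq_in_map => j jI /=.
  by rewrite (nth_map c0) //; move: jI; rewrite (perm_mem pIs) mem_iota.
have lt_S (p : 'I_n) : (reshape_index mu p < size S)%N.
  by rewrite -(size_map a) -ES reshape_indexP // intpart_sum.
exists (fun p => nth c0 S (reshape_index mu p)); split=> [p p'|c];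
  first by rewrite nth_uniq.
have [cS|cS] := boolP (c \in S).
  have lt_c : (index c S < size S)%N by rewrite index_mem.
  transitivity (nth 0%N mu (index c S)); last by rewrite ES (nth_map c0) // nth_index.
  rewrite -(fcount_block _ (intpart_sum mu)); apply: eq_card => p; rewrite !inE.
  by rewrite -{1}(nth_index c0 cS) nth_uniq.
have -> : a c = 0%N.
  by apply/eqP/negPn; move: cS; rewrite (perm_mem pS) mem_filter mem_enum andbT.
by apply: eq_card0 => p; rewrite !inE; apply: contraNF cS => /eqP <-; rewrite mem_nth.
Qed.

Lemma lam_index_subproof (p : 'I_n) : (reshape_index lam p < size lam)%N.
Proof. by rewrite reshape_indexP // intpart_sum. Qed.

Definition lam_index p : 'I_(size lam) := Ordinal (lam_index_subproof p).

Lemma fcount_lam_index i : fcount lam_index i = nth 0%N lam i.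
Proof.
by rewrite -(fcount_block _ (intpart_sum lam)); apply: eq_card => p; rewrite !inE.
Qed.

Lemma sum_pair1 (T U : finType) (m : T * U -> nat) t :
  (\sum_(p | p.1 == t) m p = \sum_u m (t, u))%N.
Proof.
rewrite (eq_bigl (fun p => pred1 t p.1 && predT p.2)) => [|p]; last by rewrite andbT.
rewrite (eq_bigr (fun p => m (p.1, p.2))) => [|[] //].
by rewrite -(pair_big (pred1 t) predT (fun t u => m (t, u))) big_pred1_eq.
Qed.

Lemma sum_pair2 (T U : finType) (m : T * U -> nat) u :
  (\sum_(p | p.2 == u) m p = \sum_t m (t, u))%N.
Proof.
rewrite (eq_bigl (fun p => predT p.1 && pred1 u p.2)) //.
rewrite (eq_bigr (fun p => m (p.1, p.2))) => [|[] //].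
rewrite -(pair_big predT (pred1 u) (fun t u => m (t, u))).
by apply: eq_bigr => t _; rewrite big_pred1_eq.
Qed.

(** The table of x counts, for each row i and variable c, the p labelled c with x p in block i of
    lam. *)
Lemma card_tables : #|[set f | is_table f]| = #|double_long n lam mu|.
Proof.
have [g [g_mu g_a]] := shape_labels.
pose pairs (x : 'S_n) p := (g p, lam_index (x p)).
pose row x i := [multinom fcount (pairs x) (c, i) | c < k].
have row_deg x i : mdeg (row x i) = nth 0%N lam i.
  rewrite mdegE -fcount_lam_index -(fcount_compose _ x).
  rewrite (@fcount_proj _ _ _ (pairs x) snd) sum_pair2.
  by apply: eq_bigr => c _; rewrite mnmE.
have row_lt x i : (mdeg (row x i) < n.+1)%N.
  rewrite row_deg ltnS -fcount_lam_index.
  by apply: leq_trans (max_card _) _; rewrite card_ord.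
pose table x := [ffun i => BMultinom (row_lt x i)] : {ffun 'I_(size lam) ->
  'X_{1..k < n.+1}}.
have table_eq x y : table x = table y <-> fcount (pairs x) =1 fcount (pairs y).
  split=> [E [c i]|E]; last first.
    by apply/ffunP=> i; rewrite !ffunE; apply/val_inj/mnmP=> c /=; rewrite !mnmE E.
  have /(congr1 (fun m : 'X_{1..k < n.+1} => (m : 'X_{1..k}) c)) := congr1 (fun f :
    {ffun _ -> _} => f i) E.
  by rewrite !ffunE /= !mnmE.
have same (x y z : 'S_n) : (forall p : 'I_n, pairs x p = pairs y (z p)) <->
    (forall p : 'I_n, (reshape_index mu p, reshape_index lam (x p)) =
               (reshape_index mu (z p), reshape_index lam (y (z p)))).
  split=> E p; have [E1 E2] := E p.
    by congr pair; [apply/eqP; rewrite -g_mu E1|exact: E2].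
  by congr pair; [apply/eqP; rewrite g_mu E1|apply: val_inj].
have table_mu x y : table x = table y <->
    perm_eq [seq (reshape_index mu p, reshape_index lam (x p)) | p : 'I_n <- enum 'I_n]
            [seq (reshape_index mu p, reshape_index lam (y p)) | p : 'I_n <- enum 'I_n].
  split=> [/table_eq /fcount_perm[z /same E]|/perm_eq_fcount /fcount_perm[z /same E]].
    rewrite (eq_map E).
    exact: (perm_map_enum (fun p :
      'I_n => (reshape_index mu p, reshape_index lam (y p)))).
  by apply/table_eq => t; rewrite (eq_fcount _ E) -[RHS](fcount_compose _ z).
rewrite -(@card_in_imset _ _ table) => [|x y xl yl /table_mu];
  last exact: double_long_inj.
apply: eq_card => f; rewrite inE; apply/idP/imsetP => [|[x _ ->]]; last first.
  apply/andP; split; first by apply/forallP=> i; rewrite ffunE /= row_deg.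
  apply/eqP/mnmP=> c; rewrite mnm_sumE -g_a.
  rewrite (@fcount_proj _ _ _ (pairs x) fst) sum_pair1.
  by apply: eq_bigr => i _; rewrite ffunE /= mnmE.
case/andP=> /forallP f_deg /eqP f_sum.
pose m (t : 'I_k * 'I_(size lam)) := (f t.2 : 'X_{1..k}) t.1.
have m1 c : (\sum_i m (c, i) = a c)%N by rewrite -f_sum mnm_sumE.
have m2 i : (\sum_c m (c, i) = nth 0%N lam i)%N by rewrite -(eqP (f_deg i)) mdegE.
have sum_m : (\sum_t m t = n)%N.
  rewrite (eq_bigr (fun t => m (t.1, t.2))) => [|[] //].
  rewrite -(pair_bigA _ (fun c i => m (c, i))) exchange_big /=.
  under eq_bigr do rewrite m2.
  by rewrite -(big_mkord predT (nth 0%N lam)) -[RHS](intpart_sum lam) sumnE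
    [RHS](big_nth 0%N).
(* To realize a given table, h takes each pair of labels as often as required; z1 aligns its first
   components with g, then z its second ones with the blocks of lam. *)
have [h h_m] := fcount_exists sum_m.
have [z1 Ez1] : exists z : 'S_n, forall p : 'I_n, g p = (h (z p)).1.
  apply: (@fcount_perm _ _ g (fst \o h)) => c.
  by rewrite g_a (@fcount_proj _ _ _ h fst) (eq_bigr m) // sum_pair1 m1.
have [z Ez] : exists z : 'S_n, forall p : 'I_n, (h (z1 p)).2 = lam_index (z p).
  apply: (@fcount_perm _ _ (snd \o (h \o z1)) lam_index) => i.
  rewrite fcount_lam_index (@fcount_proj _ _ _ (h \o z1) snd) -m2 -sum_pair2;
    apply: eq_bigr => t _.
  by rewrite fcount_compose h_m.
have fz : f = table z.
  apply/ffunP=> i; rewrite ffunE; apply/val_inj/mnmP=> c; rewrite /= mnmE.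
  rewrite -[LHS](h_m (c, i)) -(fcount_compose _ z1); apply: eq_fcount => p.
  by rewrite /pairs /= Ez1 -Ez -surjective_pairing.
have [u [v [uI vI xl]]] := double_long_exists lam mu z.
by exists (u * z * v)%g => //; rewrite fz; apply/esym/table_mu/double_coset_tables.
Qed.

End Tables.

(** * The matrix H2M *)

Section H2MDoubleCosets.

Variable n : nat.
Hypothesis n_gt0 : (0 < n)%N.
Implicit Types (lam mu : intpart n).

Lemma mcoeff_sum_bmultinom k N (P : pred 'X_{1..k}) a :
  (forall b, P b -> (mdeg b < N)%N) ->
  (\sum_(b : 'X_{1..k < N} | P b) 'X_[b] : {mpoly int[k]})@_a = (P a)%:R.
Proof.
move=> PN; rewrite raddf_sum /=; under eq_bigr do rewrite mcoeffX.
have [Pa|nPa] := boolP (P a).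
  rewrite (bigD1 (BMultinom (PN a Pa))) //= eqxx big1 ?addr0 // => b /andP[_ ba].
  case: eqP => // E; case/negP: ba; apply/eqP; exact: val_inj.
by rewrite big1 // => b Pb; case: eqP => // E; rewrite -E Pb in nPa.
Qed.

Lemma nth_intpart_le lam i : (nth 0%N lam i <= n)%N.
Proof.
rewrite -(card_block _ (intpart_sum lam)).
by apply: leq_trans (max_card _) _; rewrite card_ord.
Qed.

Lemma mcoeff_complete_syms k lam a :
  (complete_syms k lam)@_a = #|[set f : {ffun 'I_(size lam) ->
    'X_{1..k < n.+1}} | is_table a f]|%:R.
Proof.
rewrite /complete_syms (big_nth 0%N) big_mkord.
have completeE i : complete_sym k (nth 0%N lam i) =
    \sum_(b : 'X_{1..k < n.+1} | mdeg b == nth 0%N lam i) 'X_[b].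
  apply/mpolyP=> b; rewrite /complete_sym.
  rewrite (@mcoeff_sum_bmultinom _ _ (fun b => mdeg b == nth 0%N lam i)) =>
    [|c /eqP ->//].
  rewrite (@mcoeff_sum_bmultinom _ _ (fun b => mdeg b == nth 0%N lam i)) // =>
    c /eqP ->.
  by rewrite ltnS nth_intpart_le.
under eq_bigr do rewrite completeE.
rewrite bigA_distr_big_dep raddf_sum /=.
under eq_bigr do rewrite mprodXE mcoeffX.
rewrite -sum1_card natr_sum [RHS]big_mkcond [LHS]big_mkcond /=.
apply: eq_bigr => f _; rewrite in_set /is_table.
have -> : (f \in family (fun (i : 'I_(size lam)) (b :
  'X_{1..k < n.+1}) => mdeg b == nth 0%N lam i)) =
    [forall i, mdeg (f i) == nth 0%N lam i].
  by apply/familyP/forallP => H i; have := H i.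
by case: [forall i, _] => //=; case: eqP.
Qed.

Lemma mdeg_shape k (a : 'X_{1..k}) : sumn (sort geq [seq x <- (a :
  'X_{1..k}) | x != 0%N]) = mdeg a.
Proof.
rewrite (perm_sumn (s2 := [seq x <- (a : 'X_{1..k}) | x != 0%N]));
  last by rewrite perm_sort.
have -> : mdeg a = sumn (a : k.-tuple nat).
  rewrite mdegE -[in RHS](map_tnth_enum (a : k.-tuple nat)) sumnE big_map big_enum /=.
  by apply: eq_bigr => i _; rewrite mnm_tnth.
by elim: (tval _) => //= x s IHs; case: (posnP x) => [->|x0]; rewrite /= IHs.
Qed.

Lemma mcoeff_monomial_sym k mu a :
  (monomial_sym k mu)@_a = (sort geq [seq x <- (a : 'X_{1..k}) | x != 0%N] == mu)%:R.
Proof.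
rewrite /monomial_sym (@mcoeff_sum_bmultinom _ _
  (fun a => sort geq [seq x <- (a : 'X_{1..k}) | x != 0%N] == mu)) // => b /eqP E.
by rewrite -mdeg_shape E.
Qed.

Lemma is_H2M_double_long : is_H2M [ffun p :
  intpart n * intpart n => #|double_long n p.1 p.2|%:Z].
Proof.
move=> k lam; apply/mpolyP=> a; rewrite mcoeff_complete_syms raddf_sum /=.
under eq_bigr do rewrite mcoeffZ mcoeff_monomial_sym ffunE /=.
pose s := sort geq [seq x <- (a : 'X_{1..k}) | x != 0%N].
(* If the shape s of a is a partition of n, only mu = s contributes; otherwise both sides vanish. *)
have [sP|sP] := boolP [&& sorted geq s, 0%N \notin s & sumn s == n].
  rewrite (@card_tables _ _ _ (IntPart sP)) //.
  rewrite (bigD1 (IntPart sP)) //= eqxx mulr1 big1 ?addr0 ?natz // => mu ne.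
  case: eqP => // [E|_]; last by rewrite mulr0.
  by case/eqP: ne; apply: val_inj.
rewrite big1 => [|mu _]; last first.
  case: eqP => [E|_]; last by rewrite mulr0.
  by case/negP: sP; rewrite /s E; apply: valP mu.
rewrite (_ : #|_| = 0%N) //; apply: eq_card0 => f; rewrite inE; apply: contraNF sP.
case/andP=> /forallP f_deg /eqP f_sum; apply/and3P; split.
- exact/sort_sorted/geq_total.
- by rewrite mem_sort mem_filter.
rewrite mdeg_shape -f_sum mdeg_sum (eq_bigr (fun i :
  'I__ => nth 0%N lam i)) => [|i _]; last exact/eqP.
by rewrite -(big_mkord predT (nth 0%N lam)) -(big_nth 0%N predT id) -sumnE intpart_sum.
Qed.

(** In n variables every mu is an exponent, having at most n parts, and the coefficient there
    isolates one entry. Uniqueness identifies the choice made by [xget]. *)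
Lemma is_H2M_unique (M M' : {ffun intpart n * intpart n -> int}) : is_H2M M ->
  is_H2M M' -> M = M'.
Proof.
move=> HM HM'; apply/ffunP=> -[lam mu].
pose a := [multinom nth 0%N mu i | i < n].
have size_mu : (size mu <= n)%N.
  by have [] := intpart_bounds (intpart_neq0 mu); rewrite intpart_sum.
have shape : sort geq [seq x <- (a : 'X_{1..n}) | x != 0%N] = mu.
  rewrite -[RHS]intpart_sort; congr sort.
  have -> : tval a = mu ++ nseq (n - size mu) 0%N.
    apply: (@eq_from_nth _ 0%N) => [|i]; rewrite size_tuple.
      by rewrite size_cat size_nseq subnKC.
    move=> lt_in; rewrite -(mnm_nth _ a (Ordinal lt_in)) mnmE nth_cat /=.
    by case: ltnP => // le; rewrite nth_default // nth_nseq if_same.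
  rewrite filter_cat [X in _ ++ X](_ : _ = [::]) ?cats0.
    by apply/all_filterP/allP=> x xmu; apply: contraNneq (intpart_neq0 mu) => <-.
  by apply/eqP; rewrite -[_ == _]negbK -has_filter has_nseq andbF.
have coefE (N : {ffun intpart n * intpart n -> int}) : is_H2M N ->
  (complete_syms n lam)@_a = N (lam, mu).
  move=> ->; rewrite raddf_sum (bigD1 mu) //= mcoeffZ mcoeff_monomial_sym shape eqxx
    mulr1.
  rewrite big1 ?addr0 // => nu ne; rewrite mcoeffZ mcoeff_monomial_sym shape.
  by rewrite (inj_eq val_inj) eq_sym (negPf ne) mulr0.
by rewrite -(coefE M HM) -(coefE M' HM').
Qed.

Lemma H2M_double_long lam mu : H2M lam mu = #|double_long n lam mu|%:Z.
Proof.
rewrite /H2M; have := classical_sets.xgetPex [ffun=>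
  0] (ex_intro _ _ is_H2M_double_long).
by move=> /is_H2M_unique /(_ is_H2M_double_long) ->; rewrite ffunE.
Qed.

End H2MDoubleCosets.

(** * The Geck-Rouquier elements *)

Section CentralBasis.

Variable n : nat.
Implicit Types (lam mu nu : intpart n) (w : 'S_n).

Notation norm R Q lam := (normalization lam (@hecke_T R n Q (young_longest n lam) ^+
  2)).

Lemma double_long_inverse : exists b : intpart n -> intpart n -> rat,
  (forall lam nu, \sum_(mu :
    intpart n) #|double_long n lam mu|%:R * b mu nu = (lam == nu)%:R) /\
  (forall lam nu, \sum_(mu :
    intpart n) b lam mu * #|double_long n mu nu|%:R = (lam == nu)%:R).
Proof.
pose A : 'M[rat]_#|{: intpart n}| :=
  \matrix_(i, j) #|double_long n (enum_val i : intpart n) (enum_val j : intpart n)|%:R.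
have reindexE (F : 'I_#|{: intpart n}| -> rat) :
    \sum_i F i = \sum_(mu : intpart n) F (enum_rank mu).
  by rewrite (reindex (@enum_rank (intpart n))) //; apply/onW_bij/enum_rank_bij.
have uA : A \in unitmx.
  rewrite -row_free_unit -kermx_eq0; apply/eqP/row_matrixP=> i; rewrite row0.
  set v := row i _; have vA : v *m A = 0 by rewrite /v -row_mul mulmx_ker row0.
  have v0 : forall lam, v 0 (enum_rank lam) = 0.
    apply: (@double_long_nondegenerate n) => mu.
    have := congr1 (fun M : 'rV_ _ => M 0 (enum_rank mu)) vA;
      rewrite mxE [RHS]mxE reindexE => E; rewrite -[RHS]E.
    by apply: eq_bigr => lam _; rewrite [A _ _]mxE !enum_rankK.
  by apply/rowP=> j; rewrite -[j]enum_valK v0 mxE.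
exists (fun mu nu => invmx A (enum_rank mu) (enum_rank nu)); split=> lam nu.
  have := congr1 (fun M : 'M_ _ => M (enum_rank lam) (enum_rank nu)) (mulmxV uA).
  rewrite !mxE (inj_eq enum_rank_inj) reindexE => <-.
  by apply: eq_bigr => mu _; rewrite [A _ _]mxE !enum_rankK.
have := congr1 (fun M : 'M_ _ => M (enum_rank lam) (enum_rank nu)) (mulVmx uA).
rewrite !mxE (inj_eq enum_rank_inj) reindexE => <-.
by apply: eq_bigr => mu _; rewrite [A _ _]mxE !enum_rankK.
Qed.

Lemma norm_central (R : comNzRingType) (Q : R) lam : is_central (norm R Q lam).
Proof. by rewrite normalization_longest; apply: long_sum_central. Qed.

Lemma coef_norm (R : comNzRingType) (Q : R) lam mu :
  coef (norm R Q lam) (cox n mu) = #|double_long n lam mu|%:R * Q ^+ (n - size mu).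
Proof.
rewrite normalization_longest coef_long_sum_cox.
by have := size_cword (intpart_sum mu) (intpart_neq0 mu); move/(canRL (addnK _)) => ->.
Qed.

Lemma is_central_sum (R : comNzRingType) (Q : R) (c : intpart n ->
  R) (F : intpart n -> hecke n Q) :
  (forall lam, is_central (F lam)) -> is_central (\sum_lam c lam *: F lam).
Proof.
move=> cF x; rewrite /GRing.comm mulr_sumr mulr_suml; apply: eq_bigr => lam _.
by rewrite -scalerAl -scalerAr (cF lam x).
Qed.

Lemma coef_sumZ (R : comNzRingType) (Q : R) (c : intpart n -> R) (F : intpart n ->
  hecke n Q) w :
  coef (\sum_lam c lam *: F lam) w = \sum_lam c lam * coef (F lam) w.
Proof. by rewrite coef_sum; apply: eq_bigr => lam _; rewrite coefZ. Qed.

Section UnitParameter.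

Variables (R : comUnitRingType) (ratR : {rmorphism rat -> R}) (Q : R).
Hypothesis unitQ : Q \is a GRing.unit.

(** The solution is t times the inverse of the diagonal of powers of Q times the inverse of the
    double coset matrix. *)
Lemma norm_span (t : intpart n -> R) : exists c : intpart n -> R,
  forall mu, coef (\sum_lam c lam *: norm R Q lam) (cox n mu) = t mu.
Proof.
have [b [_ bA]] := double_long_inverse.
exists (fun lam => \sum_nu t nu * Q ^- (n - size nu) * ratR (b nu lam)) => mu.
rewrite coef_sumZ; under eq_bigr do rewrite coef_norm mulr_suml.
have E nu : \sum_(lam : intpart n) ratR (b nu lam) * #|double_long n lam mu|%:R =
  (nu == mu)%:R.
  rewrite -(rmorph_nat ratR) -bA rmorph_sum; apply: eq_bigr => lam _.
  by rewrite rmorphM rmorph_nat.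
transitivity (\sum_nu t nu * Q ^- (n - size nu) * (nu == mu)%:R * Q ^+ (n - size mu)).
  rewrite exchange_big; apply: eq_bigr => nu _.
  by rewrite -E mulr_sumr mulr_suml; apply: eq_bigr => lam _; rewrite !mulrA.
rewrite (bigD1 mu) //= eqxx mulr1 mulrVK ?unitrX // big1 ?addr0 // => nu /negPf ->.
by rewrite mulr0 mul0r.
Qed.

Lemma norm_free (c : intpart n -> R) :
  (forall mu, coef (\sum_lam c lam *: norm R Q lam) (cox n mu) = 0) ->
    forall lam, c lam = 0.
Proof.
move=> c0 lam; have [b [Ab _]] := double_long_inverse.
have c1 (mu : intpart n) : \sum_(lam :
  intpart n) c lam * #|double_long n lam mu|%:R = 0.
  apply: (mulIr (unitrX (n - size mu) unitQ));
    rewrite mul0r -[RHS](c0 mu) coef_sumZ mulr_suml.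
  by apply: eq_bigr => nu _; rewrite coef_norm mulrA.
transitivity (\sum_nu c nu * (nu == lam)%:R).
  by rewrite (bigD1 lam) //= eqxx mulr1 big1 ?addr0 // => nu /negPf ->; rewrite mulr0.
transitivity (\sum_(mu : intpart n) (\sum_(nu :
  intpart n) c nu * #|double_long n nu mu|%:R) * ratR (b mu lam)).
  under [RHS]eq_bigr do rewrite mulr_suml.
  rewrite exchange_big; apply: eq_bigr => nu _ /=.
  rewrite -(rmorph_nat ratR) -Ab rmorph_sum mulr_sumr; apply: eq_bigr => mu _.
  by rewrite rmorphM rmorph_nat mulrA.
by rewrite big1 // => mu _; rewrite c1 mul0r.
Qed.

Lemma norm_basis : is_basis (@is_central (hecke n Q)) (fun lam :
  intpart n => norm R Q lam).
Proof.
split=> [lam|x cx]; first exact: norm_central.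
have [c Ec] := norm_span (fun mu => coef x (cox n mu)).
have central_c (d : intpart n -> R) : is_central (\sum_lam d lam *: norm R Q lam).
  by apply: is_central_sum => lam; apply: norm_central.
exists [ffun lam => c lam]; split=> [|d Ed].
  under eq_bigr do rewrite ffunE.
  by apply: central_eq => // mu; rewrite Ec.
apply/ffunP=> lam; rewrite ffunE; apply/eqP; rewrite -subr_eq0; apply/eqP.
apply: (@norm_free (fun lam => c lam - d lam)) => mu.
rewrite coef_sumZ; under eq_bigr do rewrite mulrBl.
by rewrite sumrB -!coef_sumZ Ec -Ed subrr.
Qed.

End UnitParameter.

Lemma central_coefs_morph (R S : comNzRingType) (f : {rmorphism R ->
  S}) (Q : R) (c : 'S_n -> R) :
  central_coefs Q c -> central_coefs (f Q) (f \o c).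
Proof.
move=> cc w i; have := congr1 f (cc w i); rewrite !rmorphD !rmorphM /=.
by case: (descent w i); case: (descent (w^-1)%g i); rewrite ?rmorph0.
Qed.

Lemma central_coefs_morph_inj (R S : comNzRingType) (f : {rmorphism R ->
  S}) (Q : R) (c : 'S_n -> R) :
  injective f -> central_coefs (f Q) (f \o c) -> central_coefs Q c.
Proof.
move=> fI cc w i; apply: fI; have := cc w i; rewrite !rmorphD !rmorphM /=.
by case: (descent w i); case: (descent (w^-1)%g i); rewrite ?rmorph0.
Qed.

Lemma central_coefs_lin (R : comNzRingType) (Q : R) (c : 'S_n -> R) :
  central_coefs Q c -> is_central (\sum_w c w *: @hecke_T R n Q w).
Proof.
move=> cc; apply/central_coefsP => w i; rewrite !coef_lin; exact: cc.
Qed.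

(** For Q = 0 the algebra is the group algebra, whose central elements are class functions. *)
Lemma central_coefs0_class (R : comNzRingType) (c : 'S_n -> R) : central_coefs 0 c ->
  forall w y, c (w ^ y)%g = c w.
Proof.
move=> cc w y; have cs v i : c (v ^ s_ i)%g = c v.
  have := cc (v * s_ i)%g i; rewrite simple_conj mul_simpleK !if_same !mul0r !addr0.
  by [].
rewrite -[y]reduced_wordK; elim: (reduced_word y) w => [|i s IHs] w.
  by rewrite word_perm_nil conjg1.
by rewrite word_perm_cons conjgM IHs cs.
Qed.

(* The element is found over the field Q(X) in the span of the normalizations;   *)
(* by [central_coefs_shift], its coefficients are Z[X]-combinations of those at   *)
(* the Coxeter elements, hence in Z[X].                                           *)
Lemma geck_rouquier_exists lam : exists c, is_geck_rouquier lam c.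
Proof.
pose F := {fraction {poly rat}}.
pose phi : {rmorphism {poly int} ->
  F} := (@tofrac {poly rat}) \o (map_poly (intr : int -> rat)).
pose iota : {rmorphism rat -> F} := (@tofrac {poly rat}) \o (@polyC rat).
have phi_inj : injective phi.
  move=> p p' /= /eqP; rewrite tofrac_eq => /eqP; apply: map_inj_poly => //.
  exact: (@intr_inj rat).
have unitX : phi 'X \is a GRing.unit.
  by rewrite unitfE -(rmorph0 phi) (inj_eq phi_inj) polyX_eq0.
(* These are the coefficients that a Geck-Rouquier element must have at the Coxeter elements. *)
have [a Ea] := norm_span iota unitX (fun mu => (mu == lam)%:R).
set z := \sum_nu _ in Ea.
have cz : is_central z by apply: is_central_sum => mu; apply: norm_central.
have zcox I : sumn I = n -> 0%N \notin I ->
  coef z (cox n I) = (cycle_type (cox n I) == lam)%:R.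
  move=> sI I0; have pI : perm_eq I (cycle_part (cox n I)).
    by rewrite /= cycle_type_cox // perm_sym perm_sort.
  by rewrite (central_coef_cox cz pI) ?intpart_sum // Ea.
have zphi w : exists p, coef z w == phi p.
  elim/cyclic_shift_ind: w => [I sI I0|w i des ndes|w i des des'].
  - by exists (cycle_type (cox n I) == lam)%:R; rewrite rmorph_nat zcox.
  - rewrite (central_coefs_shift ((central_coefsP z).1 cz) des) (negPf ndes) =>
    -[p /eqP ->].
    by exists p; rewrite mul0r addr0.
  move=> [p /eqP Ep] [p' /eqP Ep']; exists (p + 'X * p').
  by rewrite (central_coefs_shift ((central_coefsP z).1 cz) des) des' Ep Ep' rmorphD
    rmorphM.
pose c w := xchoose (zphi w).
have phic w : phi (c w) = coef z w by apply/esym/eqP/(xchooseP (zphi w)).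
clearbody c.
have cc : central_coefs 'X c.
  apply: (central_coefs_morph_inj phi_inj) => w i.
  by have := (central_coefsP z).1 cz w i; rewrite -!phic.
have ccox I : sumn I = n -> 0%N \notin I ->
  c (cox n I) = (cycle_type (cox n I) == lam)%:R.
  by move=> sI I0; apply: phi_inj; rewrite phic rmorph_nat zcox.
have cmin := central_coefs_min (F := fun s => (s == lam)%:R) cc ccox.
exists [ffun w => c w]; split=> [|w|w minw].
- by under eq_bigr do rewrite ffunE; apply: central_coefs_lin.
(* At 0 the coefficients form a class function, so w can be replaced by a conjugate of minimal
   length. *)
- have [y miny] := min_in_class_exists w; rewrite ffunE -(cycle_typeJ w y).
  have cc0 : central_coefs 0 (fun w => (c w).[0]).
    by have := central_coefs_morph (horner_eval 0) cc; rewrite /= /horner_eval hornerX.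
  by rewrite -(central_coefs0_class cc0 w y) cmin // -[LHS]/(horner_eval 0 _)
    rmorph_nat.
by rewrite ffunE cmin // subrr.
Qed.

Lemma geck_rouquier_coefP lam : is_geck_rouquier lam (geck_rouquier_coef lam).
Proof. exact: classical_sets.xgetPex (geck_rouquier_exists lam). Qed.

Section GeckRouquier.

Variables (R : comNzRingType) (Q : R).

Lemma coef_geck_rouquier lam w :
  coef (geck_rouquier Q lam) w = (map_poly intr (geck_rouquier_coef lam w)).[Q].
Proof. by rewrite /geck_rouquier coef_lin. Qed.

Lemma geck_rouquier_central lam : is_central (geck_rouquier Q lam).
Proof.
have [cz _ _] := geck_rouquier_coefP lam; apply: central_coefs_lin.
pose f : {rmorphism {poly int} -> R} := horner_eval Q \o map_poly intr.
have := central_coefs_morph f ((central_coefsP _).1 cz).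
rewrite /= map_polyX /horner_eval hornerX => cc w i.
by have := cc w i; rewrite /= !coef_lin.
Qed.

Lemma coef_geck_rouquier_cox lam mu :
  coef (geck_rouquier Q lam) (cox n mu) = (mu == lam)%:R.
Proof.
have [_ _ cmin] := geck_rouquier_coefP lam; rewrite coef_geck_rouquier.
have minmu := min_in_class_cox (intpart_sum mu) (intpart_neq0 mu).
have /eqP := cmin _ minmu; rewrite subr_eq0 => /eqP ->.
by rewrite cycle_type_intpart rmorph_nat -[LHS]/(horner_eval Q _) rmorph_nat.
Qed.

End GeckRouquier.

End CentralBasis.

Theorem theorem10 (n : nat) (hn : (1 <= n)%N)
    (K : comUnitRingType) (ratK : {rmorphism rat -> K}) (q : K)
    (hq : q \is a GRing.unit) (hQ : q - q^-1 \is a GRing.unit) :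
  let Q := q - q^-1 in
  is_basis (@is_central (hecke n Q))
    (fun lam : intpart n =>
       normalization lam (hecke_T Q (young_longest n lam) ^+ 2)) /\
  (forall lam : intpart n,
     normalization lam (hecke_T Q (young_longest n lam) ^+ 2) =
     \sum_(mu : intpart n)
        ((H2M lam mu)%:~R * Q ^+ (n - size mu)) *: geck_rouquier Q mu).
Proof.
move=> Q; split=> [|lam]; first exact: norm_basis.
apply: central_eq => [||mu]; first exact: norm_central.
  by apply: is_central_sum => mu; apply: geck_rouquier_central.
rewrite coef_norm coef_sumZ (bigD1 mu) //= coef_geck_rouquier_cox eqxx mulr1.
rewrite big1 ?addr0 ?H2M_double_long // => nu /negPf ne.
by rewrite coef_geck_rouquier_cox eq_sym ne mulr0.
Qed.
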